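(* The optimal complex polynomial Bohnenblust--Hille constants satisfy \[ \limsup_{m\to\infty}\frac{\log D_m}{(\log m)^2}\le\frac{5}{8\log\bigl(4/(1+\sqrt5)\bigr)}=2.949012\ldots<2.95 . \] Equivalently, \[ D_m\le\exp\!\left(\left[\frac{5}{8\log\bigl(4/(1+\sqrt5)\bigr)}+o(1)\right](\log m)^2\right)\qquad(m\to\infty). \]
   Context: For integers $m,n\ge1$ let $\mathcal P_m(\mathbb C^n)$ be the space of $m$-homogeneous complex polynomials $P(z)=\sum_{|\alpha|=m}a_\alpha z^\alpha$ on $\mathbb C^n$. Write $\|P\|_\infty=\sup_{z\in\mathbb D^n}|P(z)|$, $q_m=\frac{2m}{m+1}$, and $\|a(P)\|_p=(\sum_\alpha|a_\alpha|^p)^{1/p}$. Define $D_{m,n}=\sup_{0\ne P\in\mathcal P_m(\mathbb C^n)}\|a(P)\|_{q_m}/\|P\|_\infty$ and $D_m=\sup_{n\ge1}D_{m,n}$ (known to be finite). *)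

(* Defs.v *)
From mathcomp Require Import all_boot all_order all_algebra.
From mathcomp Require Import complex.
From mathcomp Require Import all_classical all_reals all_analysis.
(* The notations of mpoly clash with those of MathComp-Analysis. *)
From mathcomp Require mpoly.
Import -(notations) mpoly.

Set Implicit Arguments.
Unset Strict Implicit.
Unset Printing Implicit Defensive.

Import Order.TTheory GRing.Theory Num.Theory.
Import numFieldNormedType.Exports.

Local Open Scope classical_set_scope.
Local Open Scope ring_scope.

(* [`|z|] has type [R[i]]; [cabs z] is the same modulus as an element of [R]. *)
Definition cabs (R : realType) (z : R[i]) : R := ComplexField.Normc.normc z.

Definition polydisc (R : realType) (n : nat) : set ('I_n -> R[i]) :=
  [set z | forall j, cabs (z j) < 1].

Definition supnorm (R : realType) (n : nat) (P : mpoly n R[i]) : \bar R :=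
  ereal_sup [set (cabs (meval z P))%:E | z in @polydisc R n].

(* [msupp P] lists, without repetition, the multi-indices with nonzero
   coefficient. *)
Definition coefnorm (R : realType) (p : R) (n : nat) (P : mpoly n R[i]) : R :=
  (\sum_(a <- msupp P) cabs (mcoeff a P) `^ p) `^ p^-1.

Definition BHexp (R : realType) (m : nat) : R := (2 * m)%:R / m.+1%:R.

(* The zero polynomial satisfies [ishomog1] for every degree. *)
Definition homogeneous (R : realType) (m n : nat) : set (mpoly n R[i]) :=
  [set P | P \is ishomog1 m (@mdeg n)].

(* The suprema are taken in the extended reals, so that no value is assigned
   by convention to an unbounded family. *)
Definition BHconst_dim (R : realType) (m n : nat) : \bar R :=
  ereal_sup [set ((coefnorm (BHexp R m) P)%:E / supnorm P)%E
            | P in @homogeneous R m n `\` [set 0]].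

Definition BHconst (R : realType) (m : nat) : \bar R :=
  ereal_sup [set BHconst_dim R m n | n in [set n | (1 <= n)%N]].

Definition BHrate (R : realType) : R :=
  5 / (8 * ln (4 / (1 + Num.sqrt 5))).

(* Main.v *)
Require Import Defs.
From mathcomp Require Import all_boot all_order all_algebra.
From mathcomp Require Import complex.
From mathcomp Require Import all_classical all_reals all_analysis.
From mathcomp Require mpoly.
Import -(notations) mpoly.
From mathcomp Require Import ring lra zify.

(** Let q = 2m/(m+1). A polynomial of degree m is reduced, at the price of a
    factor O(m^(3/2)) in the constant, to polynomials of degree at most 3m/4;
    iterating costs m^(3/2) at each of the log m / log(4/3) steps, whence
    log D_m <= (75/26) (log m)^2 + O(log m), and 75/26 < BHrate.

    For a family c_(g,d) of bidegree (k,l), k + l = m, with k and l comparable,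
    Blei's interpolation bounds the l^q norm of c by the mixed norms
    l^(2k/(k+1))(l^2) and l^(2l/(l+1))(l^2); the inner l^2 norm is an L^2 norm
    on a grid of roots of unity, which costs a bounded factor when replaced by
    an L^(2k/(k+1)) norm (the comparison of L^4 and L^2 is combinatorial, and
    one interpolates), and then the inequality in degree k applies.

    Bihomogeneous families come from P(t y + (1 - t) z), the convex combination
    being taken coordinatewise, by extracting the part of degree k in y. If no
    variable carries more than half of the degree of a monomial, then a random
    t in {0,1}^n splits it with m/4 <= k <= 3m/4 with probability at least 1/3.
    Otherwise t_j = 1/2 with probability 1/m and t_j = 0 else: with probability
    at least 1/(2m) only the dominant variable is mixed, and the loss is a
    central binomial coefficient, of order m^(1/2). *)

Set Implicit Arguments.
Unset Strict Implicit.
Unset Printing Implicit Defensive.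

Import Order.TTheory GRing.Theory Num.Theory.
Import numFieldNormedType.Exports.

Local Open Scope ring_scope.
Local Open Scope complex_scope.

(** * Convexity inequalities *)

(** The tangent line at the barycentre [m] lies below the graph of [expR]; averaging it over the two
    points gives the claim. With logarithms as arguments this is the weighted AM-GM inequality. *)
Lemma convex_expR2 (R : realType) (a b x y : R) :
  0 <= a -> 0 <= b -> a + b = 1 ->
  expR (a * x + b * y) <= a * expR x + b * expR y.
Proof.
move=> a0 b0 ab; set m := a * x + b * y.
have H z : expR m * (1 + (z - m)) <= expR z.
  have -> : expR z = expR m * expR (z - m) by rewrite -expRD; congr expR; lra.
  by rewrite ler_pM2l ?expR_gt0 // expR_ge1Dx.
have := lerD (ler_wpM2l a0 (H x)) (ler_wpM2l b0 (H y)); apply: le_trans.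
suff -> : a * (expR m * (1 + (x - m))) + b * (expR m * (1 + (y - m))) =
   expR m * ((a + b) + (m - (a + b) * m)) by rewrite ab; lra.
rewrite /m; ring.
Qed.

Lemma convex_expR3 (R : realType) (a b c x y z : R) :
  0 <= a -> 0 <= b -> 0 <= c -> a + b + c = 1 ->
  expR (a * x + b * y + c * z) <= a * expR x + b * expR y + c * expR z.
Proof.
move=> a0 b0 c0 ab; set m := a * x + b * y + c * z.
have H t : expR m * (1 + (t - m)) <= expR t.
  have -> : expR t = expR m * expR (t - m) by rewrite -expRD; congr expR; lra.
  by rewrite ler_pM2l ?expR_gt0 // expR_ge1Dx.
have := lerD (lerD (ler_wpM2l a0 (H x)) (ler_wpM2l b0 (H y))) (ler_wpM2l c0 (H z)).
apply: le_trans.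
suff -> : a * (expR m * (1 + (x - m))) + b * (expR m * (1 + (y - m)))
   + c * (expR m * (1 + (z - m))) =
   expR m * ((a + b + c) + (m - (a + b + c) * m)) by rewrite ab; lra.
rewrite /m; ring.
Qed.

(* Half of the exponent 2k/(k+1), as it is applied to squared moduli. *)
Definition rho (R : realType) (k : nat) : R := k%:R / k.+1%:R.

Lemma rho_gt0 (R : realType) k : (0 < k)%N -> 0 < rho R k.
Proof. by move=> k0; rewrite divr_gt0 ?ltr0n. Qed.

Lemma rho_ge0 (R : realType) k : 0 <= rho R k.
Proof. by rewrite divr_ge0. Qed.

Lemma powR_expR (R : realType) (x a : R) : 0 < x -> x `^ a = expR (a * ln x).
Proof. by move=> x0; rewrite /powR gt_eqF. Qed.

(* Interpolates L^2 between L^(2 rho_k) and L^4, for g the squared modulus. *)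
Lemma interpolation_moments (R : realType) (T : finType) (g : T -> R) (N M : R) (k d : nat) :
  (forall t, 0 <= g t) -> (0 < k)%N -> 0 <= M -> \sum_t g t = N * M ->
  \sum_t g t ^+ 2 <= N * (4 ^+ d * M ^+ 2) ->
  N * M `^ rho R k <= 4 `^ (d%:R / k.+1%:R) * \sum_t g t `^ rho R k.
Proof.
move=> g0 k0 M0 gN g2.
have rhs0 : 0 <= 4 `^ (d%:R / k.+1%:R) * \sum_t g t `^ rho R k.
  by rewrite mulr_ge0 ?powR_ge0 // sumr_ge0 // => t _; exact: powR_ge0.
move: M0; rewrite le_eqVlt => /predU1P[M0|M0].
  by rewrite -M0 powR0 ?mulr0 // gt_eqF // rho_gt0.
set lam := 4 `^ _ in rhs0 *.
have lam0 : 0 < lam by rewrite powR_gt0.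
have k1 : k.+1%:R != 0 :> R by rewrite pnatr_eq0.
have k2 : k.+2%:R != 0 :> R by rewrite pnatr_eq0.
(* The weight is determined by [s * rho R k + (1 - s) * 2 = 1]; with it the powers of 4 in [pt]
   cancel as well. *)
pose s : R := k.+1%:R / k.+2%:R.
have s0 : 0 < s by rewrite divr_gt0 ?ltr0n.
have s1 : 0 <= 1 - s.
  by rewrite subr_ge0 ler_pdivrMr ?ltr0n // mul1r ler_nat.
have pt h : 0 <= h -> h <= s * (lam * h `^ rho R k) + (1 - s) * (4 ^- d * h ^+ 2).
  rewrite le_eqVlt => /predU1P[<-|h0].
    rewrite expr0n /= !mulr0 addr0; apply: mulr_ge0; first exact: ltW.
    by rewrite mulr_ge0 ?powR_ge0 // ltW.
  have Es : s + (1 - s) = 1 by lra.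
  have := @convex_expR2 R s (1 - s) ((d%:R / k.+1%:R) * ln 4 + rho R k * ln h)
    (- (d%:R * ln 4) + 2 * ln h) (ltW s0) s1 Es.
  rewrite (expRD (d%:R / _ * _)) (expRD (- _)) -!powR_expR ?ltr0n //.
  rewrite expRN !expRM_natl !lnK ?posrE ?ltr0n //.
  rewrite (powR_mulrn _ (ltW h0)) => H; apply: le_trans H.
  have -> : s * (d%:R / k.+1%:R * ln 4 + rho R k * ln h) +
    (1 - s) * (- (d%:R * ln 4) + 2 * ln h) = ln h.
    rewrite /s /rho.
    have e1 : k.+1%:R = k%:R + 1 :> R by rewrite natr1.
    have e2 : k.+2%:R = k%:R + 2 :> R by rewrite -[in RHS]natrD addn2.
    by move: k1 k2; rewrite e1 e2 => k1 k2; field; rewrite k1 k2.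
  by rewrite lnK.
have N0 : 0 <= N * M by rewrite -gN sumr_ge0.
have key : \sum_t g t / M <= s * (lam * \sum_t (g t / M) `^ rho R k) +
    (1 - s) * (4 ^- d * \sum_t (g t / M) ^+ 2).
  rewrite 4!mulr_sumr -big_split /=; apply: ler_sum => t _.
  exact: pt (divr_ge0 (g0 t) (ltW M0)).
have M2 : \sum_t (g t / M) ^+ 2 = (\sum_t g t ^+ 2) / M ^+ 2.
  by rewrite mulr_suml; apply: eq_bigr => t _; rewrite exprMn exprVn.
have Mr : \sum_t (g t / M) `^ rho R k = (\sum_t g t `^ rho R k) / M `^ rho R k.
  rewrite mulr_suml; apply: eq_bigr => t _.
  by rewrite powRM // ?invr_ge0 ?ltW // -powR_inv1 ?ltW // -powRrM mulN1r powRN.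
move: key; rewrite -mulr_suml gN mulfK ?gt_eqF // M2 Mr => key.
have M20 : 0 < M ^+ 2 by rewrite exprn_gt0.
have d0 : (0 : R) < 4 ^+ d by rewrite exprn_gt0.
have Mr0 : 0 < M `^ rho R k by rewrite powR_gt0.
have key2 : 4 ^- d * ((\sum_t g t ^+ 2) / M ^+ 2) <= N.
  by rewrite mulrC ler_pdivrMr // ler_pdivrMr // (le_trans g2) // mulrA.
(* The quadratic term is at most [(1 - s) * N] and is absorbed on the left. *)
have {}key : s * N <= s * (lam * ((\sum_t g t `^ rho R k) / M `^ rho R k)).
  have := le_trans key (lerD (lexx _) (ler_wpM2l s1 key2)).
  by rewrite mulrBl mul1r; lra.
by move: key; rewrite ler_pM2l // mulrA ler_pdivlMr.
Qed.

Lemma powR_div (R : realType) (x y a : R) : 0 <= x -> 0 < y ->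
  (x / y) `^ a = x `^ a / y `^ a.
Proof.
move=> x0 y0; have y1 := ltW y0.
by rewrite powRM ?invr_ge0 // -powR_inv1 // -powRrM mulN1r powRN.
Qed.

(* The interpolation behind Blei's inequality, in normalized form. *)
Lemma mixed_norms_le1 (R : realType) (I J : finType) (u : I -> J -> R) (k l : nat) :
  (0 < k)%N -> (0 < l)%N -> (forall i j, 0 <= u i j) ->
  \sum_i (\sum_j u i j) `^ rho R k <= 1 ->
  \sum_j (\sum_i u i j) `^ rho R l <= 1 ->
  \sum_i \sum_j u i j `^ rho R (k + l) <= 1.
Proof.
move=> k0 l0 u0.
set A := fun i => \sum_j u i j; set B := fun j => \sum_i u i j.
rewrite -/(\sum_i A i `^ rho R k) -/(\sum_j B j `^ rho R l) => X1 Y1.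
have A0 i : 0 <= A i by apply: sumr_ge0.
have B0 j : 0 <= B j by apply: sumr_ge0.
pose c (n : nat) : R := n%:R / (k + l).+1%:R.
have c0 n : 0 <= c n by rewrite divr_ge0.
have cs : c k + c l + c 1%N = 1.
  by rewrite /c -!mulrDl -!natrD addn1 divff // pnatr_eq0.
have e1 n : n.+1%:R = n%:R + 1 :> R by rewrite natr1.
(* Weighted AM-GM with the three weights [c]: the powers of [A i] and of [B j] cancel, and [u i j]
   keeps the exponent [(k + l) / (k + l + 1)]. *)
have pt i j : u i j `^ rho R (k + l) <=
    c k * (u i j * A i `^ (- k.+1%:R^-1)) + c l * (u i j * B j `^ (- l.+1%:R^-1))
    + c 1%N * (A i `^ rho R k * B j `^ rho R l).
  have := u0 i j; rewrite le_eqVlt => /predU1P[<-|uij].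
    rewrite powR0 ?gt_eqF ?rho_gt0 ?addn_gt0 ?k0 // !mul0r !mulr0 !add0r.
    by rewrite mulr_ge0 ?c0 // mulr_ge0 ?powR_ge0.
  have Ai : 0 < A i.
    by apply: (lt_le_trans uij); rewrite /A (bigD1 j) //= lerDl sumr_ge0.
  have Bj : 0 < B j.
    by apply: (lt_le_trans uij); rewrite /B (bigD1 i) //= lerDl sumr_ge0.
  have := @convex_expR3 R (c k) (c l) (c 1%N)
    (ln (u i j) + - k.+1%:R^-1 * ln (A i)) (ln (u i j) + - l.+1%:R^-1 * ln (B j))
    (rho R k * ln (A i) + rho R l * ln (B j)) (c0 _) (c0 _) (c0 _) cs.
  rewrite (expRD (ln _) (- k.+1%:R^-1 * _)) (expRD (ln _) (- l.+1%:R^-1 * _)).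
  rewrite (expRD (rho R k * _)) -!powR_expR // !lnK ?posrE // => H.
  apply: le_trans H; rewrite powR_expR // ler_expR le_eqVlt; apply/orP; left.
  apply/eqP; rewrite /c /rho !e1 natrD.
  have k1 : k%:R + 1 != 0 :> R by rewrite natr1 pnatr_eq0.
  have l1 : l%:R + 1 != 0 :> R by rewrite natr1 pnatr_eq0.
  have kl1 : k%:R + l%:R + 1 != 0 :> R by rewrite -natrD natr1 pnatr_eq0.
  by field; rewrite k1 l1 kl1.
(* Since [- k.+1%:R^-1] is [rho R k - 1], summing [u i j] over [j] restores the power [rho R k] of
   [A i]. *)
have SA i : \sum_j u i j * A i `^ (- k.+1%:R^-1) = A i `^ rho R k.
  rewrite -mulr_suml -/(A i).
  have -> : - k.+1%:R^-1 = rho R k - 1 :> R.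
    have k1 : k%:R + 1 != 0 :> R by rewrite natr1 pnatr_eq0.
    by rewrite /rho e1; field.
  by rewrite mulr_powRB1 ?rho_gt0.
have SB j : \sum_i u i j * B j `^ (- l.+1%:R^-1) = B j `^ rho R l.
  rewrite -mulr_suml -/(B j).
  have -> : - l.+1%:R^-1 = rho R l - 1 :> R.
    have k1 : l%:R + 1 != 0 :> R by rewrite natr1 pnatr_eq0.
    by rewrite /rho e1; field.
  by rewrite mulr_powRB1 ?rho_gt0.
pose X := \sum_i A i `^ rho R k; pose Y := \sum_j B j `^ rho R l.
have X0 : 0 <= X by apply: sumr_ge0 => i _; exact: powR_ge0.
have Y0 : 0 <= Y by apply: sumr_ge0 => i _; exact: powR_ge0.
(* Summed up, the bound is a convex combination of [X], [Y] and [X * Y], each at most 1. *)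
apply: (@le_trans _ _ (c k * X + c l * Y + c 1%N * (X * Y))); last first.
  have XY : X * Y <= 1 by apply: mulr_ile1.
  have := lerD (lerD (ler_wpM2l (c0 k) X1) (ler_wpM2l (c0 l) Y1)) (ler_wpM2l (c0 1%N) XY).
  by rewrite !mulr1 cs.
have EX : c k * X = \sum_i \sum_j c k * (u i j * A i `^ (- k.+1%:R^-1)).
  by rewrite mulr_sumr; apply: eq_bigr => i _; rewrite -mulr_sumr SA.
have EY : c l * Y = \sum_i \sum_j c l * (u i j * B j `^ (- l.+1%:R^-1)).
  by rewrite exchange_big mulr_sumr; apply: eq_bigr => j _; rewrite -mulr_sumr SB.
have EXY : c 1%N * (X * Y) = \sum_i \sum_j c 1%N * (A i `^ rho R k * B j `^ rho R l).
  rewrite mulr_suml mulr_sumr; apply: eq_bigr => i _.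
  by rewrite mulr_sumr mulr_sumr.
rewrite EX EY EXY -!big_split /=; apply: ler_sum => i _.
by rewrite -!big_split /=; apply: ler_sum.
Qed.

Lemma mixed_norms (R : realType) (I J : finType) (u : I -> J -> R) (E : R) (k l : nat) :
  (0 < k)%N -> (0 < l)%N -> 0 < E -> (forall i j, 0 <= u i j) ->
  \sum_i (\sum_j u i j) `^ rho R k <= E `^ rho R k ->
  \sum_j (\sum_i u i j) `^ rho R l <= E `^ rho R l ->
  \sum_i \sum_j u i j `^ rho R (k + l) <= E `^ rho R (k + l).
Proof.
move=> k0 l0 E0 u0 hX hY.
have H := @mixed_norms_le1 R I J (fun i j => u i j / E) k l k0 l0.
have {H} : \sum_i \sum_j (u i j / E) `^ rho R (k + l) <= 1.
  apply: H => [i j||]; first by rewrite divr_ge0 // ltW.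
  - under eq_bigr do rewrite -mulr_suml powR_div ?sumr_ge0 //.
    by rewrite -mulr_suml ler_pdivrMr ?powR_gt0 // mul1r.
  - under eq_bigr do rewrite -mulr_suml powR_div ?sumr_ge0 //.
    by rewrite -mulr_suml ler_pdivrMr ?powR_gt0 // mul1r.
under eq_bigr do under eq_bigr do rewrite powR_div //.
under eq_bigr do rewrite -mulr_suml.
by rewrite -mulr_suml ler_pdivrMr ?powR_gt0 // mul1r.
Qed.

(** * Moduli and characters *)

Section Modulus.
Variable R : realType.
Implicit Types x y z : R[i].

Lemma normE z : `|z| = (cabs z)%:C. Proof. by []. Qed.

Lemma cabs_ge0 z : 0 <= cabs z.
Proof. by rewrite -ler0c -normE normr_ge0. Qed.

Lemma cabsM x y : cabs (x * y) = cabs x * cabs y.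
Proof. exact: ComplexField.Normc.normcM. Qed.

Lemma cabsV x : cabs x^-1 = (cabs x)^-1.
Proof. exact: ComplexField.Normc.normcV. Qed.

Lemma cabs0 : cabs (0 : R[i]) = 0.
Proof. exact: ComplexField.Normc.normc0. Qed.

Lemma cabs1 : cabs (1 : R[i]) = 1.
Proof. exact: ComplexField.Normc.normc1. Qed.

Lemma cabsD x y : cabs (x + y) <= cabs x + cabs y.
Proof. by rewrite -lecR rmorphD /= -!normE ler_normD. Qed.

Lemma cabs_sum (I : Type) (r : seq I) (P : pred I) (F : I -> R[i]) :
  cabs (\sum_(i <- r | P i) F i) <= \sum_(i <- r | P i) cabs (F i).
Proof.
elim/big_ind2: _ => [|x a y b hx hy|//]; first by rewrite cabs0.
by rewrite (le_trans (cabsD _ _)) // lerD.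
Qed.

Lemma cabsX x n : cabs (x ^+ n) = cabs x ^+ n.
Proof. by elim: n => [|n IH]; rewrite ?expr0 ?cabs1 // !exprS cabsM IH. Qed.

Lemma cabs_prod (I : Type) (r : seq I) (P : pred I) (F : I -> R[i]) :
  cabs (\prod_(i <- r | P i) F i) = \prod_(i <- r | P i) cabs (F i).
Proof. by elim/big_ind2: _ => [|x a y b <- <-|//]; rewrite ?cabs1 ?cabsM. Qed.

Lemma cabs_real (r : R) : 0 <= r -> cabs (r%:C) = r.
Proof. by move=> r0; apply: complexI; rewrite -normE ger0_norm // ler0c. Qed.

Lemma cabs_conj z : cabs z^* = cabs z.
Proof. by apply: complexI; rewrite -!normE normcJ. Qed.

Lemma cabs_sqr z : ((cabs z) ^+ 2)%:C = z * z^*.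
Proof. by rewrite -sqr_normc normE -rmorphXn. Qed.

Lemma cabs_eq0 z : (cabs z == 0) = (z == 0).
Proof.
apply/eqP/eqP => [|->]; last exact: cabs0.
exact: ComplexField.Normc.eq0_normc.
Qed.

Lemma cabs_nat n : cabs (n%:R : R[i]) = n%:R.
Proof. by have := @cabs_real n%:R (ler0n _ n); rewrite rmorph_nat. Qed.

End Modulus.

(** As [w ^+ (2 ^ s) = -1], no proper divisor of [2 ^ s.+1] can be the order of [w]. Powers of two
    suffice as orders, because the grids below only have to be fine enough. *)
Lemma two_power_root_of_unity (R : realType) (s : nat) :
  exists2 w : R[i], cabs w = 1 & (2 ^ s.+1).-primitive_root w.
Proof.
pose w : R[i] := (2 ^ s).-root (-1).
have ws : w ^+ (2 ^ s) = -1 by apply: rootCK; rewrite expn_gt0.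
have wN : w ^+ (2 ^ s.+1) = 1 by rewrite expnSr exprM ws sqrrN expr1n.
exists w.
  have := congr1 (@cabs R) wN; rewrite cabsX cabs1 => /eqP.
  by rewrite pexpr_eq1 ?expn_gt0 ?cabs_ge0 // => /eqP.
have [m wm mN] := @prim_order_exists _ (2 ^ s.+1) _ (expn_gt0 2 _) wN.
have /(@dvdn_pfactor 2 m s.+1 isT) [t] := mN.
rewrite leq_eqVlt => /predU1P[<- <- //|ts mt].
suff : (-1 : R[i]) == 1 by rewrite eqNr oner_eq0.
by rewrite -ws -(prim_order_dvd wm) mt dvdn_exp2l.
Qed.

Section Characters.
Variable R : realType.
Local Notation C := R[i].

Definition mono n (z : 'I_n -> C) (e : 'I_n -> nat) : C := \prod_j z j ^+ e j.

(** Bounding the exponents by [N] makes the monomials range over a finite type, so that all sums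
    over them are finite sums. *)
Definition expo n N (a : {ffun 'I_n -> 'I_N}) (j : 'I_n) : nat := a j.

Lemma expo_inj n N (a b : {ffun 'I_n -> 'I_N}) : expo a =1 expo b -> a = b.
Proof. by move=> ab; apply/ffunP => j; apply: val_inj; exact: ab. Qed.

Lemma monoD n (z : 'I_n -> C) e f : mono z (fun j => e j + f j)%N = mono z e * mono z f.
Proof. by rewrite /mono -big_split; apply: eq_bigr => j _; rewrite exprD. Qed.

Variables (M : nat) (w : C).
Hypotheses (wM : M.-primitive_root w) (w1 : cabs w = 1).

Definition root_point n (s : {ffun 'I_n -> 'I_M}) (j : 'I_n) : C := w ^+ s j.

Lemma cabs_root_point n (s : {ffun 'I_n -> 'I_M}) j : cabs (root_point s j) = 1.
Proof. by rewrite cabsX w1 expr1n. Qed.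

(** A geometric sum whose ratio [x] satisfies [x ^+ M = 1], and equals 1 only for [a = b] since both
    exponents are below the order. *)
Lemma root_sum (a b : nat) : (a < M)%N -> (b < M)%N ->
  \sum_(i < M) (w ^+ i) ^+ a * ((w ^+ i) ^+ b)^* = if a == b then M%:R else 0.
Proof.
move=> aM bM; pose x := w ^+ a * (w ^+ b)^*.
have wwc t : w ^+ t * (w ^+ t)^* = 1.
  by rewrite -cabs_sqr cabsX w1 !expr1n.
have -> : \sum_(i < M) (w ^+ i) ^+ a * ((w ^+ i) ^+ b)^* = \sum_(i < M) x ^+ i.
  by apply: eq_bigr => i _; rewrite exprAC (exprAC w i b) exprMn -rmorphXn.
case: eqVneq => [ab|ab].
  under eq_bigr do rewrite /x ab wwc expr1n.
  by rewrite sumr_const card_ord.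
have x1 : x != 1.
  apply: contra ab => /eqP xE.
  have : w ^+ a = w ^+ b by rewrite -[LHS]mulr1 -(wwc b) mulrCA -/x xE mulr1.
  by move/eqP; rewrite (eq_prim_root_expr wM) !modn_small.
have xM : x ^+ M = 1.
  by rewrite exprMn -exprM mulnC exprM (prim_expr_order wM) expr1n mul1r -rmorphXn
     -exprM mulnC exprM (prim_expr_order wM) expr1n rmorph1.
have := subrX1 x M; rewrite xM subrr => /esym/eqP; rewrite mulf_eq0.
by rewrite subr_eq0 (negPf x1) => /eqP.
Qed.

(** Orthogonality of characters on the grid: the sum factors over the coordinates. *)
Lemma character_sum n (e f : 'I_n -> nat) :
  (forall j, e j < M)%N -> (forall j, f j < M)%N ->
  \sum_(s : {ffun 'I_n -> 'I_M}) mono (root_point s) e * (mono (root_point s) f)^* =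
  if [forall j, e j == f j] then (M ^ n)%:R else 0.
Proof.
move=> eM fM.
pose F (j : 'I_n) (i : 'I_M) := (w ^+ i) ^+ e j * ((w ^+ i) ^+ f j)^*.
transitivity (\sum_(s : {ffun 'I_n -> 'I_M}) \prod_j F j (s j)).
  by apply: eq_bigr => s _; rewrite rmorph_prod -big_split.
rewrite -bigA_distr_bigA /=.
under eq_bigr do rewrite root_sum //.
case: forallP => [ef|ef].
  under eq_bigr do rewrite ef.
  by rewrite prodr_const card_ord natrX.
have /existsP [j /negPf jf] : [exists j, e j != f j].
  by rewrite -negb_forall; apply/forallP.
by rewrite (bigD1 j) //= jf mul0r.
Qed.

(** Exponents may repeat in [e], as happens when a square is expanded without collecting terms; by
    orthogonality the pairs with equal exponents survive. *)
Lemma sum_sqr_cabs n (I : finType) (b : I -> C) (e : I -> 'I_n -> nat) :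
  (forall i j, e i j < M)%N ->
  (\sum_(s : {ffun 'I_n -> 'I_M}) cabs (\sum_i b i * mono (root_point s) (e i)) ^+ 2)%:C =
  (M ^ n)%:R * \sum_i \sum_(i' | [forall j, e i j == e i' j]) b i * (b i')^*.
Proof.
move=> eM; rewrite rmorph_sum /=.
under eq_bigr do rewrite cabs_sqr rmorph_sum mulr_suml /=.
rewrite exchange_big mulr_sumr /=; apply: eq_bigr => i _.
under eq_bigr do rewrite mulr_sumr.
rewrite exchange_big mulr_sumr [RHS]big_mkcond /=; apply: eq_bigr => i' _.
under eq_bigr do rewrite rmorphM /= mulrACA.
rewrite -mulr_sumr character_sum //.
by case: ifP => _; rewrite ?mulr0 // mulrC.
Qed.

Lemma parseval n (I : finType) (b : I -> C) (e : I -> 'I_n -> nat) :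
  (forall i j, e i j < M)%N -> (forall i i', e i =1 e i' -> i = i') ->
  \sum_(s : {ffun 'I_n -> 'I_M}) cabs (\sum_i b i * mono (root_point s) (e i)) ^+ 2 =
  (M ^ n)%:R * \sum_i cabs (b i) ^+ 2.
Proof.
move=> eM e_inj; apply: complexI; rewrite sum_sqr_cabs // rmorphM rmorph_nat /=.
congr (_ * _); rewrite rmorph_sum; apply: eq_bigr => i _ /=.
rewrite cabs_sqr (big_pred1 i) // => i' /=.
by apply/forallP/eqP => [/= ei|-> //]; apply/esym/e_inj => j; apply/eqP/ei.
Qed.

(** Each surviving product is bounded by the mean of the two squares, and each index has at most [K]
    partners. *)
Lemma sum_sqr_cabs_le n (I : finType) (b : I -> C) (e : I -> 'I_n -> nat) (K : nat) :
  (forall i j, e i j < M)%N ->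
  (forall i, b i != 0 ->
     (#|[set i' | (b i' != 0%R) && [forall j, e i j == e i' j]]| <= K)%N) ->
  \sum_(s : {ffun 'I_n -> 'I_M}) cabs (\sum_i b i * mono (root_point s) (e i)) ^+ 2 <=
  (M ^ n)%:R * (K%:R * \sum_i cabs (b i) ^+ 2).
Proof.
move=> eM cardK.
set S := (X in X <= _).
have S0 : 0 <= S by apply: sumr_ge0 => s _; rewrite sqr_ge0.
rewrite -(cabs_real S0) sum_sqr_cabs // cabsM cabs_nat ler_wpM2l //.
(* Symmetry of [T] lets both halves of the mean be counted by the same row sums. *)
pose T i i' : bool := [&& b i != 0, b i' != 0 & [forall j, e i j == e i' j]].
have TC i i' : T i i' = T i' i.
  rewrite /T andbCA; congr [&& _, _ & _].
  by apply/forallP/forallP => h j; rewrite eq_sym h.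
apply: (@le_trans _ _ (\sum_i \sum_i' (T i i')%:R * (cabs (b i) ^+ 2 / 2) +
    \sum_i \sum_i' (T i i')%:R * (cabs (b i') ^+ 2 / 2))).
  apply: (le_trans (cabs_sum _ _ _)); rewrite -big_split /=; apply: ler_sum => i _.
  apply: (le_trans (cabs_sum _ _ _)); rewrite -big_split big_mkcond /=.
  apply: ler_sum => i' _; rewrite cabsM cabs_conj /T.
  case: ifP => _; last by rewrite !andbF !mul0r addr0.
  case: eqVneq => [->|_]; first by rewrite cabs0 !mul0r addr0.
  case: eqVneq => [->|_]; first by rewrite cabs0 mulr0 !mul0r addr0.
  rewrite /= !mul1r; have := sqr_ge0 (cabs (b i) - cabs (b i')); rewrite sqrrB.
  by move: (cabs (b i)) (cabs (b i')) => x y; rewrite -subr_ge0; lra.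
have -> : \sum_i \sum_i' (T i i')%:R * (cabs (b i') ^+ 2 / 2) =
          \sum_i \sum_i' (T i i')%:R * (cabs (b i) ^+ 2 / 2).
  by rewrite exchange_big; do 2!(apply: eq_bigr => ? _); rewrite TC.
rewrite -big_split mulr_sumr /=; apply: ler_sum => i _.
rewrite -big_split /=.
have -> : \sum_i' ((T i i')%:R * (cabs (b i) ^+ 2 / 2) + (T i i')%:R * (cabs (b i) ^+ 2 / 2)) =
   (\sum_i' (T i i')%:R) * cabs (b i) ^+ 2.
  by rewrite mulr_suml; apply: eq_bigr => i' _; lra.
apply: ler_wpM2r; first exact: sqr_ge0.
have [bi0|bi0] := eqVneq (b i) 0.
  by rewrite big1 // => i' _; rewrite /T bi0 eqxx.
apply: (@le_trans _ _ (#|[set i' | (b i' != 0) && [forall j, e i j == e i' j]]|%:R)); last first.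
  by rewrite ler_nat cardK.
rewrite -sum1_card natr_sum [leRHS]big_mkcond /= ler_sum // => i' _.
by rewrite inE /T bi0 /=; case: ifP.
Qed.

End Characters.

(** * Hypercontractivity and bihomogeneous families *)

Definition wt n N (a : {ffun 'I_n -> 'I_N}) : nat := (\sum_j a j)%N.

Lemma card_ord_le N g : (#|[pred x : 'I_N | x <= g]| <= g.+1)%N.
Proof.
rewrite -[leqRHS]card_ord -(@card_in_imset _ _ (fun x : 'I_N => inord x : 'I_g.+1)) ?max_card //.
move=> x y; rewrite !inE => xg yg /(congr1 val) /=.
by rewrite !inordK // => /val_inj.
Qed.

(* A monomial of degree 2d has at most 4^d factorizations into two monomials. *)
Lemma card_factorizations n N (Q : pred ({ffun 'I_n -> 'I_N} * {ffun 'I_n -> 'I_N}))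
    (g : 'I_n -> nat) :
  (#|[set i | Q i & [forall j, g j == i.1 j + i.2 j]]| <= 2 ^ (\sum_j g j))%N.
Proof.
set S := [set i | _].
(* The first factor determines the second, so first factors are counted: coordinatewise at most
   [g j + 1 <= 2 ^ g j] choices. *)
have inj : {in S &, injective (@fst {ffun 'I_n -> 'I_N} {ffun 'I_n -> 'I_N})}.
  move=> [a b] [a' b'] /=; rewrite !inE /= => /andP[_ /forallP h] /andP[_ /forallP h'] aa'.
  subst a'; congr pair; apply/ffunP => j; apply: val_inj; apply/eqP.
  by rewrite -(eqn_add2l (a j)) -(eqP (h j)) (eqP (h' j)).
rewrite -(card_in_imset inj).
have : [set i.1 | i in S] \subset family (fun j => [pred x : 'I_N | x <= g j]%N).
  apply/fintype.subsetP => a /imsetP[[a' b]]; rewrite inE /= => /andP[_ /forallP h] ->.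
  by apply/familyP => j; rewrite inE (eqP (h j)) leq_addr.
move/subset_leq_card/leq_trans; apply; rewrite card_family expn_sum foldrE big_map big_enum /=.
apply: leq_prod => j _; apply: (leq_trans (card_ord_le _ _)); exact: ltn_expl.
Qed.

Section Split.
Variable R : realType.
Local Notation C := R[i].

Definition polyval n N (c : {ffun 'I_n -> 'I_N} -> C) (z : 'I_n -> C) : C :=
  \sum_a c a * mono z (expo a).

Definition homog_coef n N k (c : {ffun 'I_n -> 'I_N} -> C) :=
  forall a, wt a != k -> c a = 0.

(** The Bohnenblust--Hille inequality of degree [k] with constant [D], uniform in the number of
    variables, normalized on the closed polydisc and raised to the power [2k/(k+1)]. *)
Definition BH (k : nat) (D : R) := forall n N (c : {ffun 'I_n -> 'I_N} -> C),
  homog_coef k c ->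
  (forall z, (forall j, cabs (z j) <= 1) -> cabs (polyval c z) <= 1) ->
  \sum_a (cabs (c a) ^+ 2) `^ rho R k <= (D ^+ 2) `^ rho R k.

Variables (M : nat) (w : C).
Hypotheses (wM : M.-primitive_root w) (w1 : cabs w = 1).

(* The L^2 norm is at most 2^(d/k) <= 8 times the L^(2k/(k+1)) norm. *)
Lemma hypercontractive n N d k (c : {ffun 'I_n -> 'I_N} -> C) :
  (2 * N <= M)%N -> homog_coef d c -> (0 < k)%N -> (d <= 3 * k)%N ->
  (M ^ n)%:R * (\sum_a cabs (c a) ^+ 2) `^ rho R k <=
  64 `^ rho R k * \sum_s (cabs (polyval c (@root_point _ M w n s)) ^+ 2) `^ rho R k.
Proof.
move=> NM hc k0 dk.
pose g s := cabs (polyval c (@root_point _ M w n s)) ^+ 2.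
have M0 : 0 <= \sum_a cabs (c a) ^+ 2 by apply: sumr_ge0 => a _; exact: sqr_ge0.
have aM (a : {ffun 'I_n -> 'I_N}) j : (a j < M)%N.
  by apply: leq_trans (ltn_ord _) (leq_trans _ NM); lia.
have H := @interpolation_moments R _ g (M ^ n)%:R (\sum_a cabs (c a) ^+ 2) k d.
apply: (le_trans (H _ k0 M0 _ _)).
- by move=> s; exact: sqr_ge0.
- by apply: (parseval wM w1) => [a j|a b]; [exact: aM | exact: expo_inj].
(* The fourth moment is the second moment of the square, expanded over pairs of monomials; its
   exponents stay below [2 * N <= M], and a monomial occurs at most [2 ^ (2 * d)] times. *)
- pose b (i : {ffun 'I_n -> 'I_N} * {ffun 'I_n -> 'I_N}) := c i.1 * c i.2.
  pose e (i : {ffun 'I_n -> 'I_N} * {ffun 'I_n -> 'I_N}) j := (i.1 j + i.2 j)%N.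
  have -> : \sum_s g s ^+ 2 =
     \sum_(s : {ffun 'I_n -> 'I_M}) cabs (\sum_i b i * mono (root_point w s) (e i)) ^+ 2.
    apply: eq_bigr => s _; rewrite /g -cabsX (expr2 (polyval _ _)); congr (cabs _ ^+ 2).
    transitivity (\sum_x \sum_y b (x, y) * mono (root_point w s) (e (x, y))).
      rewrite /polyval mulr_suml; apply: eq_bigr => x _.
      by rewrite mulr_sumr; apply: eq_bigr => y _; rewrite mulrACA -monoD.
    by rewrite pair_bigA; apply: eq_bigr => -[].
  have -> : 4 ^+ d * (\sum_a cabs (c a) ^+ 2) ^+ 2 = (4 ^ d)%:R * \sum_i cabs (b i) ^+ 2.
    rewrite natrX; congr (_ * _).
    transitivity (\sum_x \sum_y cabs (b (x, y)) ^+ 2).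
      rewrite expr2 mulr_suml; apply: eq_bigr => x _.
      by rewrite mulr_sumr; apply: eq_bigr => y _; rewrite cabsM exprMn.
    by rewrite pair_bigA; apply: eq_bigr => -[].
  apply: (sum_sqr_cabs_le wM w1) => [[x y] j|[x y]].
    by rewrite /e (leq_trans _ NM) // mul2n -addnn -addSn leq_add // ltnW.
  rewrite /b /= => bxy; apply: (leq_trans (card_factorizations _ _)).
  rewrite /e /= big_split /=.
  have -> : (\sum_j x j)%N = d.
    by apply/eqP; apply: contraNT bxy => /hc ->; rewrite mul0r.
  have -> : (\sum_j y j)%N = d.
    by apply/eqP; apply: contraNT bxy => /hc ->; rewrite mulr0.
  by rewrite addnn -mul2n expnM.
(* Here [d <= 3 * k] turns [4 ^ (d / (k + 1))] into at most [64 ^ (k / (k + 1))]. *)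
- apply: ler_wpM2r; first by apply: sumr_ge0 => s _; exact: powR_ge0.
  have -> : 64 = 4 ^+ 3 :> R by ring.
  rewrite -powR_mulrn // -powRrM; apply: ler_powR; first by rewrite ler1n.
  rewrite /rho mulrA ler_pM2r ?invr_gt0 ?ltr0n // -natrM ler_nat //.
Qed.

(** For each [a], hypercontractivity in the second variable replaces the inner sum by an average
    over grid points; at each grid point the inequality of degree [k] applies to the first
    variable. *)
Lemma mixed_norm_left n N k l D (c : {ffun 'I_n -> 'I_N} -> {ffun 'I_n -> 'I_N} -> C) :
  (2 * N <= M)%N -> BH k D -> (0 < k)%N -> (l <= 3 * k)%N ->
  (forall a b, wt a != k -> c a b = 0) -> (forall a b, wt b != l -> c a b = 0) ->
  (forall y z, (forall j, cabs (y j) <= 1) -> (forall j, cabs (z j) <= 1) ->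
    cabs (\sum_a \sum_b c a b * (mono y (expo a) * mono z (expo b))) <= 1) ->
  \sum_a (\sum_b cabs (c a b) ^+ 2) `^ rho R k <= (64 * D ^+ 2) `^ rho R k.
Proof.
move=> NM BHk k0 lk hk hl c1.
have M0 : (0 < M)%N by apply: prim_order_gt0 wM.
have Mn : 0 < (M ^ n)%:R :> R by rewrite ltr0n expn_gt0 M0.
rewrite -(ler_pM2l Mn) mulr_sumr.
apply: (@le_trans _ _ (\sum_a 64 `^ rho R k *
   \sum_s (cabs (polyval (c a) (@root_point _ M w n s)) ^+ 2) `^ rho R k)).
  by apply: ler_sum => a _; apply: (@hypercontractive _ _ l) => // b; exact: hl.
rewrite -mulr_sumr exchange_big powRM ?sqr_ge0 // mulrCA.
apply: ler_wpM2l; first exact: powR_ge0.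
have -> : (M ^ n)%:R * (D ^+ 2) `^ rho R k = \sum_(s : {ffun 'I_n -> 'I_M}) (D ^+ 2) `^ rho R k.
  by rewrite sumr_const card_ffun !card_ord mulr_natl.
apply: ler_sum => s _; apply: (BHk n N (fun a => polyval (c a) (@root_point _ M w n s))).
  by move=> a ak; rewrite /polyval big1 // => b _; rewrite hk // mul0r.
move=> z z1; rewrite /polyval.
have p1 j : cabs (root_point w s j) <= 1 by rewrite cabs_root_point.
apply: le_trans (c1 z (root_point w s) z1 p1).
rewrite le_eqVlt; apply/orP; left; apply/eqP; congr cabs.
apply: eq_bigr => a _; rewrite mulr_suml; apply: eq_bigr => b _.
by rewrite -mulrA; congr (_ * _); rewrite mulrC.
Qed.

End Split.

(** Both mixed norms come from [mixed_norm_left], the second after exchanging the two variables;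
    [mixed_norms] combines them. *)
Lemma BH_bihomogeneous (R : realType) n N k l D
    (c : {ffun 'I_n -> 'I_N} -> {ffun 'I_n -> 'I_N} -> R[i]) :
  BH k D -> BH l D -> 0 < D ->
  (0 < k)%N -> (0 < l)%N -> (l <= 3 * k)%N -> (k <= 3 * l)%N ->
  (forall a b, wt a != k -> c a b = 0) -> (forall a b, wt b != l -> c a b = 0) ->
  (forall y z, (forall j, cabs (y j) <= 1) -> (forall j, cabs (z j) <= 1) ->
    cabs (\sum_a \sum_b c a b * (mono y (expo a) * mono z (expo b))) <= 1) ->
  \sum_a \sum_b (cabs (c a b) ^+ 2) `^ rho R (k + l) <= (64 * D ^+ 2) `^ rho R (k + l).
Proof.
move=> BHk BHl D0 k0 l0 lk kl hk hl c1.
have [w w1 wM] := two_power_root_of_unity R (2 * N).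
have NM : (2 * N <= 2 ^ (2 * N).+1)%N by rewrite ltnW // ltnW // ltn_expl.
apply: mixed_norms => //.
- by rewrite mulr_gt0 // exprn_gt0.
- by move=> *; exact: sqr_ge0.
- exact: (mixed_norm_left wM w1 NM BHk k0 lk hk hl c1).
- apply: (mixed_norm_left wM w1 NM BHl l0 kl (c := fun b a => c a b)) => //.
    by move=> a b; exact: hl.
  by move=> a b; exact: hk.
move=> y z y1 z1; apply: le_trans (c1 z y z1 y1).
rewrite exchange_big le_eqVlt; apply/orP; left; apply/eqP; congr cabs.
by do 2!(apply: eq_bigr => ? _); rewrite (mulrC (mono z _)).
Qed.

(** * Substitution of convex combinations *)

(** The binomial theorem as a sum over both exponents independently, so that a product of such
    powers can be distributed into a double sum over exponent functions. *)
Lemma exprDn_double (K : comPzRingType) (u v : K) (N a : nat) : (a < N)%N ->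
  (u + v) ^+ a = \sum_(x < N) \sum_(y < N)
    (if a == (x + y)%N then ('C(a, x)%:R * (u ^+ x * v ^+ y)) else 0).
Proof.
move=> aN; rewrite addrC exprDn.
rewrite (big_ord_widen_cond N xpredT (fun i : nat => (v ^+ (a - i) * u ^+ i) *+ 'C(a, i))) //=.
rewrite big_mkcond /=; apply: eq_bigr => x _.
case: ifP => xa.
  have aN' : (a - x < N)%N by apply: leq_ltn_trans (leq_subr _ _) aN.
  rewrite (bigD1 (Ordinal aN')) //= subnKC // eqxx big1 ?addr0.
    by rewrite mulr_natl mulrC.
  move=> y; rewrite -val_eqE /= => yx; case: eqP => // axy.
  by rewrite axy addKn eqxx in yx.
rewrite big1 // => y _; case: eqP => // axy.
by rewrite axy ltnS leq_addr in xa.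
Qed.

Section Polarization.
Variable R : realType.
Local Notation C := R[i].
Variables (n N : nat) (a : {ffun 'I_n -> 'I_N} -> C) (t : 'I_n -> R).
Hypothesis t01 : forall j, 0 <= t j <= 1.

(* Coefficients of the substitution of t_j y_j + (1 - t_j) z_j for the j-th
   variable. *)
Definition mix_coef (g d : {ffun 'I_n -> 'I_N}) : C :=
  \sum_b a b * \prod_j (if (b j == g j + d j :> nat)%N then
     'C(b j, g j)%:R * ((t j)%:C ^+ g j * (1 - (t j)%:C) ^+ d j) else 0).

Definition mix_point (y z : 'I_n -> C) (j : 'I_n) : C :=
  (t j)%:C * y j + (1 - (t j)%:C) * z j.

Lemma polyval_mix y z :
  polyval a (mix_point y z) =
  \sum_g \sum_d mix_coef g d * (mono y (expo g) * mono z (expo d)).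
Proof.
pose F (b : {ffun 'I_n -> 'I_N}) (j : 'I_n) (x x' : 'I_N) : C :=
  if (b j == x + x' :> nat)%N then
     'C(b j, x)%:R * (((t j)%:C * y j) ^+ x * ((1 - (t j)%:C) * z j) ^+ x') else 0.
transitivity (\sum_b a b * \sum_(g : {ffun 'I_n -> 'I_N}) \sum_(d : {ffun 'I_n -> 'I_N})
    \prod_j F b j (g j) (d j)).
  apply: eq_bigr => b _; congr (_ * _).
  under [RHS]eq_bigr do rewrite -(bigA_distr_bigA (fun j x' => F b j (_ j) x')).
  rewrite -(bigA_distr_bigA (fun j x => \sum_x' F b j x x')).
  apply: eq_bigr => j _; rewrite /mix_point /expo.
  exact: (exprDn_double _ _ (ltn_ord (b j))).
under eq_bigr do rewrite mulr_sumr.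
rewrite exchange_big; apply: eq_bigr => g _ /=.
under eq_bigr do rewrite mulr_sumr.
rewrite exchange_big; apply: eq_bigr => d _ /=.
rewrite mulr_suml; apply: eq_bigr => b _.
rewrite -mulrA -!big_split /=; congr (_ * _); apply: eq_bigr => j _.
rewrite /F /expo; case: ifP => _; last by rewrite mul0r.
by rewrite !exprMn -!mulrA; congr (_ * _); congr (_ * _); rewrite mulrCA.
Qed.

Lemma mix_coef_wt m g d : homog_coef m a -> (wt g + wt d)%N != m -> mix_coef g d = 0.
Proof.
move=> ha gd; apply: big1 => b _.
have [bm|/ha ->] := eqVneq (wt b) m; last by rewrite mul0r.
have [j jb] : exists j, (b j != g j + d j :> nat)%N.
  apply/existsP; apply: contraNT gd; rewrite negb_exists => /forallP h.
  rewrite -bm /wt -big_split /=; apply/eqP/esym/eq_bigr => j _.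
  by apply/eqP; have := h j; rewrite negbK.
by rewrite (bigD1 j) //= (negPf jb) mul0r mulr0.
Qed.

(** Only [b = g + d] contributes, so a mixed coefficient is an original one times an explicit
    scalar; bounds can thus be transferred back to [a]. *)
Lemma mix_coefE (b g d : {ffun 'I_n -> 'I_N}) : (forall j, b j = g j + d j :> nat)%N ->
  mix_coef g d =
    a b * \prod_j ('C(b j, g j)%:R * ((t j)%:C ^+ g j * (1 - (t j)%:C) ^+ d j)).
Proof.
move=> bgd; rewrite /mix_coef (bigD1 b) //= [X in _ + X]big1 ?addr0.
  by congr (_ * _); apply: eq_bigr => j _; rewrite bgd eqxx.
move=> b' b'b.
have [j jb] : exists j, (b' j != g j + d j :> nat)%N.
  apply/existsP; apply: contraNT b'b; rewrite negb_exists => /forallP h.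
  apply/eqP/ffunP => j; apply: val_inj; rewrite /= bgd.
  by apply/eqP; have := h j; rewrite negbK.
by rewrite (bigD1 j) //= (negPf jb) mul0r mulr0.
Qed.

Lemma cabs_mix_point y z j : cabs (y j) <= 1 -> cabs (z j) <= 1 ->
  cabs (mix_point y z j) <= 1.
Proof.
move=> y1 z1; have /andP[t0 t1] := t01 j.
apply: (le_trans (cabsD _ _)); rewrite !cabsM.
have -> : 1 - (t j)%:C = (1 - t j)%:C by rewrite rmorphB.
rewrite !cabs_real ?subr_ge0 //.
have s0 : 0 <= 1 - t j by rewrite subr_ge0.
by have := lerD (ler_wpM2l t0 y1) (ler_wpM2l s0 z1); rewrite !mulr1 [leRHS]addrC subrK.
Qed.

Variable m : nat.
Hypothesis ha : homog_coef m a.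
Hypothesis a1 : forall z, (forall j, cabs (z j) <= 1) -> cabs (polyval a z) <= 1.

(** The part of degree [k] in [y] is a Fourier coefficient of the rotation of [y] by roots of unity,
    hence an average of values of modulus at most 1. *)
Lemma mix_component_le1 k y z :
  (forall j, cabs (y j) <= 1) -> (forall j, cabs (z j) <= 1) ->
  cabs (\sum_g \sum_d (if wt g == k then mix_coef g d else 0) *
     (mono y (expo g) * mono z (expo d))) <= 1.
Proof.
move=> y1 z1.
(* The order exceeds [m] and [k], so degree [k] is isolated exactly and not merely modulo the
   order. *)
have [w w1 wM] := two_power_root_of_unity R (m + k).
set M := (2 ^ (m + k).+1)%N in wM.
have Mmk : (m + k < M)%N by rewrite ltnW // ltn_expl.
have M0 : 0 < M%:R :> R by rewrite ltr0n expn_gt0.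
set S := (X in cabs X).
pose zeta (i : 'I_M) (j : 'I_n) := w ^+ i * y j.
have zeta1 i j : cabs (zeta i j) <= 1 by rewrite cabsM cabsX w1 expr1n mul1r.
have mono_zeta i e : mono (zeta i) e = (w ^+ i) ^+ (\sum_j e j)%N * mono y e.
  by rewrite /mono -prodrXr -big_split; apply: eq_bigr => j _; rewrite exprMn.
have SE : M%:R * S = \sum_(i < M) polyval a (mix_point (zeta i) z) * ((w ^+ i) ^+ k)^*.
  rewrite /S; under [RHS]eq_bigr do rewrite polyval_mix mulr_suml.
  rewrite [RHS]exchange_big mulr_sumr; apply: eq_bigr => g _ /=.
  under [RHS]eq_bigr do rewrite mulr_suml.
  rewrite [RHS]exchange_big mulr_sumr; apply: eq_bigr => d _ /=.
  have [gd|/(mix_coef_wt ha) gd] := eqVneq (wt g + wt d)%N m; last first.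
    by rewrite gd if_same !mul0r mulr0 big1 // => i _; rewrite !mul0r.
  transitivity ((\sum_(i < M) (w ^+ i) ^+ wt g * ((w ^+ i) ^+ k)^*) *
      (mix_coef g d * (mono y (expo g) * mono z (expo d)))).
    rewrite (root_sum wM w1); last 2 first.
    - by rewrite (leq_ltn_trans _ Mmk) // -gd -addnA leq_addr.
    - by rewrite (leq_ltn_trans _ Mmk) // leq_addl.
    by case: eqP => _; rewrite ?mul0r ?mulr0.
  rewrite mulr_suml; apply: eq_bigr => i _.
  rewrite mono_zeta -/(wt g).
  by move: (mix_coef g d) (mono y _) (mono z _) (w ^+ i ^+ wt g) ((w ^+ i ^+ k)^*) => *; ring.
rewrite -(ler_pM2l M0). rewrite mulr1 -[M%:R]cabs_nat -cabsM SE.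
apply: (le_trans (cabs_sum _ _ _)); rewrite cabs_nat.
have -> : M%:R = \sum_(i < M) (1 : R) by rewrite sumr_const card_ord.
apply: ler_sum => i _; rewrite cabsM cabs_conj !cabsX w1 !expr1n mulr1.
by apply: a1 => j; apply: cabs_mix_point.
Qed.

Lemma mix_component_bound k l D : m = (k + l)%N -> BH k D -> BH l D -> 0 < D ->
  (0 < k)%N -> (0 < l)%N -> (l <= 3 * k)%N -> (k <= 3 * l)%N ->
  \sum_(g | wt g == k) \sum_d (cabs (mix_coef g d) ^+ 2) `^ rho R m
    <= (64 * D ^+ 2) `^ rho R m.
Proof.
move=> mkl BHk BHl D0 k0 l0 lk kl.
pose c g d := if wt g == k then mix_coef g d else 0.
have := @BH_bihomogeneous R n N k l D c BHk BHl D0 k0 l0 lk kl.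
rewrite -mkl => H; apply: le_trans (H _ _ _).
- rewrite big_mkcond /=; apply: ler_sum => g _; rewrite /c.
  by case: ifP => // _; apply: sumr_ge0 => d _; exact: powR_ge0.
- by move=> g d /negPf gk; rewrite /c gk.
- move=> g d dl; rewrite /c; case: eqP => // gk; apply: (mix_coef_wt ha).
  by rewrite gk mkl eqn_add2l.
- exact: mix_component_le1.
Qed.

End Polarization.

(** * Counting splittings *)

Lemma Posz_sum (I : Type) (r : seq I) (P : pred I) (F : I -> nat) :
  (\sum_(i <- r | P i) F i)%N%:Z = \sum_(i <- r | P i) (F i)%:Z.
Proof. exact: (big_morph Posz PoszD). Qed.

Section Signs.
Variable n : nat.
Implicit Types S : {ffun 'I_n -> bool}.

Definition flip (i : 'I_n) S : {ffun 'I_n -> bool} :=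
  [ffun j => if j == i then ~~ S j else S j].

Lemma flipK i : involutive (flip i).
Proof. by move=> S; apply/ffunP => j; rewrite !ffunE; case: (j == i); rewrite ?negbK. Qed.

Definition sgn S (j : 'I_n) : int := if S j then 1 else -1.

Lemma sgn_flip i S j : sgn (flip i S) j = if j == i then - sgn S j else sgn S j.
Proof. by rewrite /sgn ffunE; case: (j == i); case: (S j). Qed.

(** For distinct indices, flipping the sign at [i] maps the sum to its negative. *)
Lemma sum_sgn2 i j : \sum_S sgn S i * sgn S j = if i == j then (2 ^ n)%:R else 0.
Proof.
case: eqVneq => [<-|ij].
  rewrite (eq_bigr (fun=> 1)) => [|S _]; last by rewrite /sgn; case: (S i).
  by rewrite sumr_const card_ffun card_bool card_ord.
have : \sum_S sgn S i * sgn S j = - \sum_S sgn S i * sgn S j.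
  rewrite [LHS](reindex_inj (inv_inj (flipK i))) /= -sumrN; apply: eq_bigr => S _.
  by rewrite !sgn_flip eqxx eq_sym (negPf ij) mulNr.
lia.
Qed.

Lemma second_moment (c : 'I_n -> int) (P : pred 'I_n) :
  \sum_S (\sum_(j | P j) sgn S j * c j) ^+ 2 = (2 ^ n)%:R * \sum_(j | P j) c j ^+ 2.
Proof.
under eq_bigr do rewrite expr2 mulr_suml.
rewrite exchange_big mulr_sumr; apply: eq_bigr => i Pi /=.
under eq_bigr do rewrite mulr_sumr.
rewrite exchange_big (bigD1 i) //= [X in _ + X]big1 ?addr0.
  under eq_bigr do rewrite mulrACA.
  by rewrite -mulr_suml sum_sgn2 eqxx expr2.
move=> j /andP[_ ji]; under eq_bigr do rewrite mulrACA.
by rewrite -mulr_suml sum_sgn2 eq_sym (negPf ji) mul0r.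
Qed.

(* Chebyshev for the signed sum over the coordinates other than the largest one,
   whose sign can then be chosen to bring the total back towards 0. *)
Lemma many_balanced_splits (a : 'I_n -> nat) (m : nat) :
  (0 < m)%N -> (\sum_j a j)%N = m -> (forall j, 2 * a j <= m)%N ->
  (2 ^ n <= 3 * #|[pred S : {ffun 'I_n -> bool} | (m <= 4 * \sum_(j | S j) a j <= 3 * m)%N]|)%N.
Proof.
move=> m0 am a2.
have [j1 _] : exists j : 'I_n, true.
  apply/existsP; apply: contraTT m0; rewrite negb_exists => /forallP h.
  by rewrite -am big1 // => j; have := h j.
have [j0 _ jmax] := @arg_maxnP _ j1 xpredT a isT.
set G := [pred S : {ffun 'I_n -> bool} | _].
pose Y S : int := \sum_(j | j != j0) sgn S j * (a j)%:Z.
(* If [2 * |Y S| <= T], giving [j0] the sign opposite to [Y S] brings the signed total to at most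
   [m / 2] in modulus, because [a j0 <= m / 2]. *)
pose T : int := 2 * (a j0)%:Z + m%:Z.
pose B := [pred S : {ffun 'I_n -> bool} | T < 2 * `|Y S|].
have YM S : 2 * (\sum_(j | S j) a j)%N%:Z - m%:Z = sgn S j0 * (a j0)%:Z + Y S.
  rewrite -am (bigID S xpredT) /= /Y.
  have -> : sgn S j0 * (a j0)%:Z + \sum_(j | j != j0) sgn S j * (a j)%:Z =
    \sum_j sgn S j * (a j)%:Z by rewrite [RHS](bigD1 j0).
  rewrite [RHS](bigID S xpredT) /=.
  have -> : \sum_(j | S j) sgn S j * (a j)%:Z = (\sum_(j | S j) a j)%N%:Z.
    by rewrite Posz_sum; apply: eq_bigr => j Sj; rewrite /sgn Sj mul1r.
  have -> : \sum_(j | ~~ S j) sgn S j * (a j)%:Z = - (\sum_(j | ~~ S j) a j)%N%:Z.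
    by rewrite Posz_sum -sumrN; apply: eq_bigr => j Sj; rewrite /sgn (negPf Sj) mulN1r.
  by rewrite PoszD opprD addrA mulr_natl mulr2n addrK.
have Yflip S : Y (flip j0 S) = Y S.
  by apply: eq_bigr => j /negPf jj0; rewrite sgn_flip jj0.
have cover S : [|| B S, G S | G (flip j0 S)].
  have /= := YM S; have /= := YM (flip j0 S); rewrite Yflip sgn_flip eqxx.
  have := a2 j0; rewrite /B /G /T /= /sgn.
  case: (S j0); lia.
have cB : (3 * #|B| <= 2 ^ n)%N.
  have T0 : 0 < T ^+ 2 by rewrite exprn_gt0 // /T; lia.
  have B1 : #|B|%:R * T ^+ 2 <= \sum_S 4 * Y S ^+ 2.
    rewrite -sum1_card natr_sum mulr_suml big_mkcond /=; apply: ler_sum => S _.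
    case: ifP => [|_]; last by rewrite mulr_ge0 // sqr_ge0.
    rewrite inE /= => TY; rewrite mul1r.
    have -> : 4 * Y S ^+ 2 = (2 * `|Y S|) ^+ 2 by rewrite exprMn real_normK ?num_real.
    by rewrite ler_pXn2r // ?nnegrE; rewrite /T; lia.
  have B2 : \sum_(j | j != j0) (a j)%:Z ^+ 2 <= (a j0)%:Z * (m%:Z - (a j0)%:Z).
    have -> : m%:Z - (a j0)%:Z = \sum_(j | j != j0) (a j)%:Z.
      by rewrite -am (bigD1 j0) //= -Posz_sum; lia.
    rewrite mulr_sumr; apply: ler_sum => j _; rewrite expr2 ler_wpM2r //.
    by rewrite lez_nat; exact: jmax.
  (* The difference of the two sides is the square [(4 a_j0 - m)^2]; the resulting factor 3 gives
     the bad event probability at most 1/3. *)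
  have B3 : 12 * ((a j0)%:Z * (m%:Z - (a j0)%:Z)) <= T ^+ 2.
    have := sqr_ge0 (4 * (a j0)%:Z - m%:Z); rewrite /T.
    by move: (a j0)%:Z m%:Z => x y; rewrite -subr_ge0; lra.
  rewrite -(ler_nat int) -(ler_pM2r T0) natrM.
  move: B1; rewrite -mulr_sumr second_moment => B1.
  have p0 : 0 <= (2 ^ n)%:R :> int by [].
  have := ler_wpM2l p0 B2; have := ler_wpM2l p0 B3; move: B1.
  move: ((2 ^ n)%:R) (#|B|%:R) (T ^+ 2) (\sum_(j | j != j0) _) => p b t s.
  move: ((a j0)%:Z * _) => q; lra.
(* [flip j0] is a bijection, so the two good alternatives in [cover] are equally numerous. *)
have cG : (2 ^ n <= #|B| + 2 * #|G|)%N.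
  have -> : (2 ^ n)%N = #|{ffun 'I_n -> bool}| by rewrite card_ffun card_bool card_ord.
  have GG : #|[pred S : {ffun 'I_n -> bool} | G (flip j0 S)]| = #|G|.
    rewrite -(fintype.card_image (inv_inj (flipK j0)) G); apply: eq_card => S.
    rewrite !inE; apply/idP/fintype.imageP => [GS|[S' GS' ->]].
      by exists (flip j0 S); rewrite ?flipK.
    by rewrite flipK.
  have cnt (A : pred {ffun 'I_n -> bool}) : #|A| = (\sum_S A S)%N.
    by rewrite -sum1_card big_mkcond; apply: eq_bigr => S _; rewrite unfold_in; case: (A S).
  rewrite mul2n -addnn -[X in (_ + (_ + X))%N]GG !cnt -!big_split /=.
  have orb_leq (x y z : bool) : [|| x, y | z] -> (1 <= x + (y + z))%N by case: x y z => [] [] [].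
  by apply: leq_sum => S _; exact: orb_leq (cover S).
lia.
Qed.

End Signs.

(** Bernoulli's inequality for [(1 - 1/(m+1))^r], denominators cleared; truncated subtraction makes
    the left side 0 for [r > m]. *)
Lemma bernoulli_nat (m r : nat) : ((m.+1 - r) * m.+1 ^ r <= m ^ r * m.+1)%N.
Proof.
elim: r => [|r IH]; first by rewrite subn0 !expn0 mul1n muln1.
rewrite !expnS.
have : (m * ((m.+1 - r) * m.+1 ^ r) <= m * (m ^ r * m.+1))%N by rewrite leq_mul2l IH orbT.
move: (m.+1 ^ r)%N (m ^ r)%N => x y h.
apply: (@leq_trans (m * ((m.+1 - r) * x))); last by lia.
rewrite [leqRHS]mulnA mulnA leq_mul2r; apply/orP; right.
case: (leqP r m) => rm; nia.
Qed.

(** The value [z0], of probability [1/m], marks a mixed variable. The other variables present number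
    at most [m - a j0 <= m/2], so by Bernoulli none of them is mixed with probability at least 1/2,
    independently of [j0]. *)
Lemma many_single_mixes n m (z0 : 'I_m) (a : 'I_n -> nat) (j0 : 'I_n) :
  z0 = 0%N :> nat -> (\sum_j a j)%N = m -> (m <= 2 * a j0)%N ->
  (m ^ n <= 2 * m *
     #|[pred f : {ffun 'I_n -> 'I_m} |
         (f j0 == z0) && [forall j, (j != j0) ==> (a j != 0) ==> (f j != z0)]]|)%N.
Proof.
case: m z0 => [[]//|m] z0 z00; have {z0 z00} -> : z0 = ord0 by exact: val_inj.
move=> am a0.
pose F j := [pred x : 'I_m.+1 | if j == j0 then x == ord0 else (a j != 0%N) ==> (x != ord0)].
have -> : #|[pred f : {ffun 'I_n -> 'I_m.+1} |
   (f j0 == ord0) && [forall j, (j != j0) ==> (a j != 0%N) ==> (f j != ord0)]]| = #|family F|.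
  apply: eq_card => f; rewrite !inE; apply/andP/familyP => [[f0 /forallP h] j|h].
    by rewrite inE; case: eqVneq => [->//|jj0]; have := h j; rewrite jj0.
  split; first by have := h j0; rewrite !inE eqxx.
  by apply/forallP => j; apply/implyP => jj0; have := h j; rewrite !inE (negPf jj0).
rewrite card_family foldrE big_map big_enum /= (bigD1 j0) //=.
have -> : #|F j0| = 1%N by rewrite -(card1 (@ord0 m)); apply: eq_card => x; rewrite !inE eqxx.
rewrite mul1n (bigID (fun j => a j != 0%N)) /=.
have -> : (\prod_(j | (j != j0) && (a j != 0%N)) #|F j| = \prod_(j | (j != j0) && (a j != 0%N)) m)%N.
  apply: eq_bigr => j /andP[/negPf jj0 aj].
  have cm : #|predC1 (@ord0 m)| = m by rewrite cardC1 card_ord.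
  rewrite -[RHS]cm.
  by apply: eq_card => x; rewrite !inE jj0 aj.
have -> : (\prod_(j | (j != j0) && ~~ (a j != 0%N)) #|F j| =
           \prod_(j | (j != j0) && ~~ (a j != 0%N)) m.+1)%N.
  apply: eq_bigr => j /andP[/negPf jj0 /negPf aj].
  have cm : #|'I_m.+1| = m.+1 by rewrite card_ord.
  rewrite -[RHS]cm.
  by apply: eq_card => x; rewrite !inE jj0 aj.
rewrite !prod_nat_const.
set r := #|_|; set s := #|_|.
have rs : n = (r + s).+1.
  transitivity (\sum_(j < n) 1)%N; first by rewrite sum_nat_const card_ord muln1.
  rewrite (bigD1 j0) //= (bigID (fun j => a j != 0%N)) /=.
  by rewrite !sum1_card.
have r_le : (2 * r <= m.+1)%N.
  suff : (r + a j0 <= m.+1)%N by lia.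
  rewrite /r -am (bigD1 j0) //= addnC leq_add2l -sum1_card [leqLHS]big_mkcondr leq_sum // => j _.
  by case: (a j).
rewrite rs expnS expnD.
have := bernoulli_nat m r; move: (m.+1 ^ r)%N (m ^ r)%N (m.+1 ^ s)%N => x y z h.
suff : (x <= 2 * y)%N by nia.
nia.
Qed.

(** * Lower bounds for central binomial coefficients *)

Lemma bin_central_step n : ('C(2 * n.+1, n.+1) * n.+1 = 2 * ((2 * n).+1 * 'C(2 * n, n)))%N.
Proof.
have -> : (2 * n.+1 = (2 * n).+2)%N by lia.
have e : 'C((2 * n).+1, n) = 'C((2 * n).+1, n.+1).
  by rewrite -[LHS]bin_sub; [congr ('C(_, _)); lia | lia].
rewrite binS e; have := mul_bin_diag (2 * n).+1 n; rewrite /= => ->; lia.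
Qed.

(** By [bin_central_step] the induction step reduces to [4 n (n + 1) <= (2 n + 1)^2]. *)
Lemma bin_central_even n : (0 < n)%N -> (16 ^ n <= 4 * n * 'C(2 * n, n) ^ 2)%N.
Proof.
elim: n => // -[_ _|n IH _]; first by [].
have {IH} := IH isT; have := bin_central_step n.+1.
move: n.+1 (ltn0Sn n) => {}n n0; rewrite (expnS 16).
move: (16 ^ n)%N ('C(2 * n, n)) ('C(2 * n.+1, n.+1)) => p c c' cc' h.
rewrite -(@leq_pmul2r (n.+1)) //.
have -> : (4 * n.+1 * c' ^ 2 * n.+1 = 4 * (c' * n.+1) ^ 2)%N by rewrite -!mulnn; ring.
rewrite cc'; apply: (@leq_trans (16 * (4 * n * c ^ 2) * n.+1)); first by rewrite leq_mul2r leq_mul2l h !orbT.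
rewrite -!mulnn.
have -> : (4 * (2 * ((2 * n).+1 * c) * (2 * ((2 * n).+1 * c))) = 16 * ((2 * n).+1 * (2 * n).+1 * (c * c)))%N by ring.
have -> : (16 * (4 * n * (c * c)) * n.+1 = 16 * (4 * n * n.+1 * (c * c)))%N by ring.
rewrite leq_mul2l leq_mul2r; apply/orP; right; apply/orP; right; nia.
Qed.

Lemma bin_central_odd n : ('C((2 * n).+1, n.+1) * 2 = 'C(2 * n.+1, n.+1))%N.
Proof.
have -> : (2 * n.+1 = (2 * n).+2)%N by lia.
have e : 'C((2 * n).+1, n) = 'C((2 * n).+1, n.+1).
  by rewrite -[LHS]bin_sub; [congr ('C(_, _)); lia | lia].
by rewrite [RHS]binS e addnn muln2.
Qed.

Lemma bin_central a : (0 < a)%N -> (4 ^ a <= 4 * a * 'C(a, uphalf a) ^ 2)%N.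
Proof.
have [n [-> n0|-> _]] : exists n, a = (2 * n)%N \/ a = (2 * n).+1.
  exists a./2; have := odd_double_half a; case: (odd a) => /= <-; lia.
- have -> : uphalf (2 * n) = n by rewrite mul2n uphalf_double.
  have n1 : (0 < n)%N by lia.
  have := bin_central_even n1; rewrite (expnM 4); move/leq_trans; apply.
  by rewrite leq_mul2r; apply/orP; right; lia.
- have -> : uphalf (2 * n).+1 = n.+1 by rewrite mul2n /= doubleK.
  have := bin_central_odd n; have := bin_central_even (ltn0Sn n).
  rewrite (expnS 16) => h e; rewrite -e in h; rewrite (expnS 4) (expnM 4).
  move: h; rewrite -!mulnn; have -> : (4 * 4 = 16)%N by [].
  by move: (16 ^ n)%N ('C(_, _)) => p c h; nia.
Qed.

(** * The recursion *)

(** Double counting: each [b] in [Y] is captured by at least a fraction [1/c] of the outcomes, and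
    every outcome obeys the bound [B]. *)
Lemma averaging (R : realFieldType) (O A : finType) (X : O -> pred A) (Y : pred A)
    (F : A -> R) (B : R) (c : nat) :
  (0 < #|O|)%N -> (forall b, 0 <= F b) ->
  (forall b, Y b -> #|O| <= c * #|[pred o | X o b]|)%N ->
  (forall o, \sum_(b | X o b) F b <= B) -> \sum_(b | Y b) F b <= c%:R * B.
Proof.
move=> O0 F0 hY hX.
have O0' : 0 < #|O|%:R :> R by rewrite ltr0n.
rewrite -(ler_pM2l O0').
apply: (@le_trans _ _ (c%:R * \sum_o \sum_(b | X o b) F b)); last first.
  rewrite mulrCA ler_wpM2l //.
  have -> : #|O|%:R * B = \sum_(o : O) B by rewrite sumr_const mulr_natl.
  exact: ler_sum.
rewrite (exchange_big_dep xpredT) //= !mulr_sumr big_mkcond /=.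
apply: ler_sum => b _.
have e : \sum_(o | X o b) F b = #|[pred o | X o b]|%:R * F b.
  by rewrite sumr_const mulr_natl; congr (_ *+ _); apply: eq_card.
case: ifP => Yb; last by rewrite e !mulr_ge0.
by rewrite e mulrA -natrM ler_wpM2r // ler_nat hY.
Qed.

(** The minimum keeps the value in ['I_N] unconditionally; it equals [x] where [x <= i]. *)
Definition ord_below N (i : 'I_N) (x : nat) : 'I_N :=
  Ordinal (leq_ltn_trans (geq_minl i x) (ltn_ord i)).

Section Step.
Variable R : realType.
Local Notation C := R[i].
Variables (n N m : nat) (a : {ffun 'I_n -> 'I_N} -> C) (D : R).
Hypothesis m2 : (1 < m)%N.
Hypothesis D0 : 0 < D.
Hypothesis hBH : forall k, (m <= 4 * k)%N -> (4 * k <= 3 * m)%N -> BH k D.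
Hypothesis ha : homog_coef m a.
Hypothesis a1 : forall z, (forall j, cabs (z j) <= 1) -> cabs (polyval a z) <= 1.

Let E : R := 64 * D ^+ 2.
Let window k := (m <= 4 * k <= 3 * m)%N.

Lemma mix_window_bound t : (forall j, 0 <= t j <= 1) ->
  \sum_(g | window (wt g)) \sum_d (cabs (mix_coef a t g d) ^+ 2) `^ rho R m
   <= (2 * m)%:R * E `^ rho R m.
Proof.
move=> t01.
have E0 : 0 <= E `^ rho R m by exact: powR_ge0.
rewrite (partition_big (fun g => inord (wt g) : 'I_m.+1) window); last first.
  by move=> g; rewrite /window => /andP[g1 g2]; rewrite inordK ?g1 //; lia.
(* There are at most [m + 1 <= 2m] degrees [k] in the window. *)
apply: (@le_trans _ _ (\sum_(k < m.+1) E `^ rho R m)); last first.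
  by rewrite sumr_const card_ord -[leLHS]mulr_natl ler_wpM2r // ler_nat; lia.
rewrite big_mkcond /=; apply: ler_sum => k _; case: ifP => // /andP[k1 k2].
have mk : m = (k + (m - k))%N by have := ltn_ord k; lia.
have H := @mix_component_bound R n N a t t01 m ha a1 k (m - k) D mk.
apply: le_trans (H _ _ D0 _ _ _ _); last 6 first.
- exact: hBH.
- by apply: hBH; lia.
- lia.
- lia.
- lia.
- lia.
rewrite [leLHS]big_mkcond [leRHS]big_mkcond /=; apply: ler_sum => g _.
have s0 : 0 <= \sum_d (cabs (mix_coef a t g d) ^+ 2) `^ rho R m.
  by apply: sumr_ge0 => d _; exact: powR_ge0.
case: ifP => [/andP[/andP[g1 g2] /eqP gk]|_]; last by case: ifP.
by rewrite ifT // -gk inordK //; lia.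
Qed.

(** Each [b] in [X] is split as [x b] and [b - x b]. Distinct [b] give distinct pairs, so the left
    side is a partial sum of the one in [mix_window_bound]. *)
Lemma mix_selection_bound (t : 'I_n -> R) (X : pred {ffun 'I_n -> 'I_N})
    (x : {ffun 'I_n -> 'I_N} -> 'I_n -> nat) :
  (forall j, 0 <= t j <= 1) ->
  (forall b j, X b -> x b j <= b j)%N ->
  (forall b, X b -> window (\sum_j x b j)) ->
  \sum_(b | X b) (cabs (a b) ^+ 2 * (\prod_j ('C(b j, x b j)%:R *
       (t j ^+ x b j * (1 - t j) ^+ (b j - x b j)))) ^+ 2) `^ rho R m
   <= (2 * m)%:R * E `^ rho R m.
Proof.
move=> t01 xb Xw; apply: le_trans (mix_window_bound t01).
pose G (b : {ffun 'I_n -> 'I_N}) : {ffun 'I_n -> 'I_N} := [ffun j => ord_below (b j) (x b j)].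
pose H (b : {ffun 'I_n -> 'I_N}) : {ffun 'I_n -> 'I_N} := [ffun j => ord_below (b j) (b j - x b j)].
have GE (b : {ffun 'I_n -> 'I_N}) j : X b -> G b j = x b j :> nat by move=> Xb; rewrite ffunE /=; apply/minn_idPr/xb.
have HE (b : {ffun 'I_n -> 'I_N}) j : X b -> H b j = (b j - x b j)%N :> nat.
  by move=> Xb; rewrite ffunE /=; apply/minn_idPr/leq_subr.
have GH (b : {ffun 'I_n -> 'I_N}) j : X b -> b j = (G b j + H b j)%N :> nat.
  by move=> Xb; rewrite GE // HE // subnKC // xb.
pose V (p : {ffun 'I_n -> 'I_N} * {ffun 'I_n -> 'I_N}) :=
  (cabs (mix_coef a t p.1 p.2) ^+ 2) `^ rho R m.
have -> : \sum_(g | window (wt g)) \sum_d (cabs (mix_coef a t g d) ^+ 2) `^ rho R m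
  = \sum_(p | window (wt p.1)) V p.
  rewrite [RHS](eq_bigl (fun p => window (wt p.1) && true)); last by move=> p; rewrite andbT.
  by rewrite -(pair_big (fun g => window (wt g)) xpredT (fun g d => V (g, d))).
pose h b := (G b, H b).
have h_inj : {in X &, injective h}.
  move=> b b' Xb Xb' [/ffunP g1 /ffunP g2]; apply/ffunP => j; apply: val_inj.
  by rewrite /= GH // [RHS]GH // g1 g2.
have -> : \sum_(b | X b) (cabs (a b) ^+ 2 * (\prod_j ('C(b j, x b j)%:R *
       (t j ^+ x b j * (1 - t j) ^+ (b j - x b j)))) ^+ 2) `^ rho R m =
   \sum_(b | X b) V (h b).
  apply: eq_bigr => b Xb; rewrite /V /h /=; congr (_ `^ _).
  rewrite (mix_coefE _ _ (fun j => GH b j Xb)) cabsM exprMn; congr (_ * _ ^+ 2).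
  rewrite cabs_prod; apply: eq_bigr => j _.
  have /andP[t0 t1] := t01 j.
  have t1' : 0 <= 1 - t j by rewrite subr_ge0.
  have -> : 1 - (t j)%:C = (1 - t j)%:C by rewrite rmorphB.
  by rewrite !cabsM cabs_nat !cabsX !cabs_real // GE // HE.
have -> : \sum_(b | X b) V (h b) = \sum_(b in [set b | X b]) V (h b).
  by apply: eq_bigl => b; rewrite inE.
rewrite -(big_imset V (h := h)) /=; last by move=> b b'; rewrite !inE; exact: h_inj.
rewrite [leLHS]big_mkcond [leRHS]big_mkcond /=; apply: ler_sum => p _.
have V0 : 0 <= V p by exact: powR_ge0.
case: ifP => [/imsetP[b]|_]; last by case: ifP.
rewrite inE => Xb ->; rewrite ifT //= /wt.
by under eq_bigr do rewrite GE //; exact: Xw.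
Qed.

Let B := (2 * m)%:R * E `^ rho R m.
Let F (b : {ffun 'I_n -> 'I_N}) := (cabs (a b) ^+ 2) `^ rho R m.

Lemma no_dominant_bound :
  \sum_(b | (wt b == m) && [forall j, (2 * b j <= m)%N]) F b <= 3%:R * B.
Proof.
pose X (S : {ffun 'I_n -> bool}) := [pred b : {ffun 'I_n -> 'I_N} | window (\sum_(j | S j) b j)].
apply: (averaging (X := X)).
- by rewrite card_ffun card_bool expn_gt0.
- by move=> b; exact: powR_ge0.
- move=> b /andP[/eqP bm /forallP b2].
  rewrite card_ffun card_bool card_ord.
  exact: (@many_balanced_splits n (fun j => b j) m (ltnW m2) bm b2).
(* With [t] an indicator, the split of [b] along [S] has scalar factor 1. *)
move=> S; pose t j : R := (S j)%:R.
have := @mix_selection_bound t (X S) (fun b j => if S j then b j : nat else 0%N).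
move=> H; apply: le_trans (H _ _ _).
- apply: ler_sum => b _; rewrite [X in _ * X ^+ 2]big1 ?expr1n ?mulr1 // => j _.
  rewrite /t; case: (S j).
    by rewrite binn subnn expr1n expr0 !mulr1.
  by rewrite bin0 subn0 expr0 subr0 expr1n !mulr1.
- by move=> j; rewrite /t; case: (S j); rewrite ?lexx ?ler01.
- by move=> b j _; case: ifP.
- by move=> b; rewrite /X inE -big_mkcond.
Qed.

Lemma dominant_bound :
  \sum_(b | (wt b == m) && [exists j, (m < 2 * b j)%N]) F b <=
  (2 * m)%:R * ((4 * m)%:R `^ rho R m * B).
Proof.
have m0 : (0 < m)%N by exact: ltnW.
pose z0 : 'I_m := Ordinal m0.
pose good (b : {ffun 'I_n -> 'I_N}) (j0 : 'I_n) (f : {ffun 'I_n -> 'I_m}) :=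
  (f j0 == z0) && [forall j, (j != j0) ==> (b j != 0 :> nat)%N ==> (f j != z0)].
pose X (f : {ffun 'I_n -> 'I_m}) := [pred b : {ffun 'I_n -> 'I_N} |
   (wt b == m) && [exists j0, (m < 2 * b j0)%N && good b j0 f]].
apply: (averaging (X := X)).
- by rewrite card_ffun !card_ord expn_gt0 m0.
- by move=> b; exact: powR_ge0.
- move=> b /andP[/eqP bm /existsP[j0 bj0]].
  rewrite card_ffun !card_ord.
  have /leq_trans : (m ^ n <= 2 * m * #|[pred f | good b j0 f]|)%N.
    exact: (@many_single_mixes n m z0 (fun j => b j) j0 erefl bm (ltnW bj0)).
  apply; rewrite leq_mul2l; apply/orP; right; apply: subset_leq_card.
  apply/fintype.subsetP => f; rewrite !inE bm eqxx /= => gf.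
  by apply/existsP; exists j0; rewrite bj0.
(* For a good outcome only [j0] is mixed, its exponent being halved; the squared factor
   [('C(b, uphalf b) / 2 ^ b) ^ 2] is at least [1 / (4m)] by [bin_central]. *)
move=> f; pose t j : R := if f j == z0 then 2^-1 else 0.
have := @mix_selection_bound t (X f) (fun b j => if f j == z0 then uphalf (b j) else 0%N).
move=> H; rewrite mulrC -ler_pdivrMr ?powR_gt0 ?ltr0n ?muln_gt0 //.
apply: le_trans (H _ _ _).
- rewrite mulr_suml; apply: ler_sum => b /andP[/eqP bm /existsP[j0 /andP[bj0 /andP[fj0 /forallP fj]]]].
  rewrite /F -powR_div ?sqr_ge0 ?ltr0n ?muln_gt0 //.
  have s0 : 0 <= cabs (a b) ^+ 2 by exact: sqr_ge0.
  apply: ge0_ler_powR; rewrite ?nnegrE ?rho_ge0 //.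
  - by rewrite divr_ge0.
  - by rewrite mulr_ge0 // sqr_ge0.
  apply: ler_wpM2l => //.
  rewrite (bigD1 j0) //= [X in (_ * X) ^+ 2]big1 ?mulr1; last first.
    move=> j jj0; have := fj j; rewrite jj0 /= /t.
    case: (f j == z0); last first.
      by rewrite bin0 subn0 expr0 subr0 expr1n !mulr1.
    by rewrite implybF negbK => /eqP ->; rewrite bin0 !expr0 !mulr1.
  rewrite /t fj0.
  have -> : 1 - 2^-1 = 2^-1 :> R by lra.
  rewrite -exprD subnKC ?leq_uphalf_double; last by lia.
  have b0 : (0 < b j0)%N by rewrite lt0n; apply: contraTneq bj0 => ->; rewrite muln0.
  have bjm : (b j0 <= m)%N by rewrite -bm /wt (bigD1 j0) //= leq_addr.
  have := bin_central b0; rewrite -(ler_nat R) !natrM !natrX => hb.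
  rewrite exprMn exprVn -exprVn -exprM mulnC exprM.
  have -> : 2^-1 ^+ 2 = 4^-1 :> R by lra.
  have m4 : 0 < 4 * m%:R :> R by rewrite mulr_gt0 ?ltr0n.
  rewrite exprVn ler_pdivlMr ?exprn_gt0 // mulrC ler_pdivrMr //.
  apply: (le_trans hb); rewrite expr2 [leRHS]mulrC ler_wpM2r ?mulr_ge0 //.
  by rewrite ler_wpM2l // ler_nat.
- by move=> j; rewrite /t; case: ifP => _; lra.
- by move=> b j _; case: ifP => _ //; lia.
- move=> b /andP[/eqP bm /existsP[j0 /andP[bj0 /andP[fj0 /forallP fj]]]].
  rewrite (bigD1 j0) //= fj0 big1 ?addn0; last first.
    move=> j jj0; have := fj j; rewrite jj0 /=.
    by case: (f j == z0); rewrite // implybF negbK => /eqP ->.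
  have bjm : (b j0 <= m)%N by rewrite -bm /wt (bigD1 j0) //= leq_addr.
  by rewrite /window; lia.
Qed.

End Step.

Lemma le_powR_rho (R : realType) (x y : R) m :
  0 <= x -> 0 <= y -> x ^+ m.+1 <= y ^+ m -> x <= y `^ rho R m.
Proof.
move=> x0 y0 xy.
have m1 : m.+1%:R != 0 :> R by rewrite pnatr_eq0.
have -> : x = (x ^+ m.+1) `^ m.+1%:R^-1.
  by rewrite -powR_mulrn // -powRrM divff // powRr1.
have -> : y `^ rho R m = (y ^+ m) `^ m.+1%:R^-1.
  by rewrite -powR_mulrn // -powRrM.
by apply: ge0_ler_powR; rewrite ?nnegrE ?exprn_ge0.
Qed.

Lemma BH_step (R : realType) m (D : R) : (1 < m)%N -> 0 < D ->
  (forall k, (m <= 4 * k)%N -> (4 * k <= 3 * m)%N -> BH k D) ->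
  BH m (224 * (m%:R * Num.sqrt m%:R) * D).
Proof.
move=> m2 D0 hBH n N a ha a1.
have m0 : (0 < m)%N by exact: ltnW.
set F := fun b => (cabs (a b) ^+ 2) `^ rho R m.
have Fwt b : wt b != m -> F b = 0.
  by move=> /ha abm; rewrite /F abm cabs0 expr0n /= powR0 // gt_eqF // rho_gt0.
have := lerD (no_dominant_bound m2 D0 hBH ha a1) (dominant_bound m2 D0 hBH ha a1).
rewrite -/F.
have -> : \sum_b F b = \sum_(b | (wt b == m) && [forall j, (2 * b j <= m)%N]) F b +
   \sum_(b | (wt b == m) && [exists j, (m < 2 * b j)%N]) F b.
  rewrite (bigID (fun b => wt b == m)) /= [X in _ + X]big1 ?addr0; last first.
    by move=> b; exact: Fwt.
  rewrite (bigID (fun b : {ffun 'I_n -> 'I_N} => [forall j, (2 * b j <= m)%N])) /=.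
  congr (_ + _); apply: eq_bigl => b; rewrite negb_forall; congr (_ && _).
  by apply: eq_existsb => j; rewrite -ltnNge.
move=> H; apply: (le_trans H) => {H}.
set q := (4 * m)%:R `^ rho R m.
have x1 : 1 <= m%:R :> R by rewrite ler1n.
have x2 : 2 <= m%:R :> R by rewrite ler_nat.
have q1 : 1 <= q.
  rewrite -[leLHS](powRr0 ((4 * m)%:R : R)); apply: ler_powR; last exact: rho_ge0.
  by rewrite ler1n muln_gt0.
have e0 : 0 <= (64 * D ^+ 2) `^ rho R m by exact: powR_ge0.
(* The prefactors total at most [7 m^2 q]. Taking [196 = 7 * 28] reduces [key] to [7 m^2 <= 28^m],
   which follows from [m <= 2^m]. *)
have key : 7 * m%:R ^+ 2 <= (196 * m%:R ^+ 2) `^ rho R m.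
  apply: le_powR_rho; rewrite ?mulr_ge0 ?exprn_ge0 //.
  rewrite exprS.
  have -> : 196 * m%:R ^+ 2 = 28 * (7 * m%:R ^+ 2) :> R by ring.
  rewrite [leRHS]exprMn ler_wpM2r ?exprn_ge0 ?mulr_ge0 ?exprn_ge0 //.
  rewrite -!natrX -natrM ler_nat.
  have -> : (28 = 7 * (2 * 2))%N by [].
  rewrite !expnMn -mulnn !leq_mul //; last 2 first.
  - by rewrite ltnW // ltn_expl.
  - by rewrite ltnW // ltn_expl.
  by rewrite -[leqLHS]expn1 leq_exp2l.
(* Indeed [224 ^ 2 = 196 * 4 * 64]. *)
have -> : (224 * (m%:R * Num.sqrt m%:R) * D) ^+ 2 =
    (196 * m%:R ^+ 2) * ((4 * m)%:R * (64 * D ^+ 2)).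
  rewrite !exprMn sqr_sqrtr // natrM; ring.
have d0 : 0 <= 64 * D ^+ 2 by rewrite mulr_ge0 // sqr_ge0.
have m4 : 0 <= 196 * m%:R ^+ 2 :> R by rewrite mulr_ge0 ?exprn_ge0.
rewrite (powRM _ m4) ?(mulr_ge0 _ d0) // (powRM _ (ler0n _ (4 * m)) d0) -/q.
apply: le_trans (ler_wpM2r (mulr_ge0 (le_trans ler01 q1) e0) key).
rewrite natrM; move: (m%:R) x1 x2 q q1 (_ `^ _) e0 => x x1 x2 q q1 e e0.
have q10 : 0 <= q - 1 by rewrite subr_ge0.
have x20 : 0 <= x - 2 by rewrite subr_ge0.
have x0 : 0 <= x := le_trans ler01 x1.
have q0 : 0 <= q := le_trans ler01 q1.
have h1 := mulr_ge0 q10 (mulr_ge0 x0 e0).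
have h2 := mulr_ge0 x20 (mulr_ge0 (mulr_ge0 x0 q0) e0).
rewrite -subr_ge0.
have -> : 7 * x ^+ 2 * (q * e) - (3 * (2 * x * e) + 2 * x * (q * (2 * x * e))) =
  6 * ((q - 1) * (x * e)) + 3 * ((x - 2) * (x * q * e)) by ring.
by rewrite addr_ge0 // mulr_ge0.
Qed.

(** * Iteration *)

Lemma BH_le (R : realType) k (D D' : R) : 0 <= D -> D <= D' -> BH k D -> BH k D'.
Proof.
move=> D0 DD' h n N c hc c1; apply: (le_trans (h n N c hc c1)).
have D'0 := le_trans D0 DD'.
by apply: ge0_ler_powR; rewrite ?nnegrE ?exprn_ge0 ?rho_ge0 // lerXn2r.
Qed.

Lemma wt1P n N (a : {ffun 'I_n -> 'I_N}) : wt a = 1%N ->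
  exists j, forall i, a i = (i == j) :> nat.
Proof.
move=> a1.
have [j aj] : exists j, (a j != 0 :> nat)%N.
  apply/existsP; apply: contra_eqT a1; rewrite negb_exists => /forallP h.
  by rewrite /wt big1 // => j _; have := h j; rewrite negbK => /eqP.
move: a1; rewrite /wt (bigD1 j) //= => a1; exists j => i.
have split1 (x y : nat) : (x != 0 -> x + y = 1 -> x = 1 /\ y = 0)%N by lia.
have [aj1 /eqP] := split1 _ _ aj a1; rewrite sum_nat_eq0 => /forallP h.
by case: eqVneq => [->|ij]; [rewrite aj1 | have := h i; rewrite ij => /eqP].
Qed.

(** Evaluating a linear form at the conjugate phases of its coefficients gives the sum of their
    moduli. *)
Lemma BH_degree1 (R : realType) : BH 1 (1 : R).
Proof.
move=> n N c hc c1.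
have -> : rho R 1 = 2^-1 by rewrite /rho div1r.
rewrite expr1n powR1.
under eq_bigr do rewrite powR12_sqrt ?sqr_ge0 // sqrtr_sqr ger0_norm ?cabs_ge0 //.
pose ph (x : R[i]) : R[i] := x^* / (cabs x)%:C.
pose unit_at j (a : {ffun 'I_n -> 'I_N}) := [forall i, a i == (i == j) :> nat].
(* The unit multi-index at [j] may be missing from the family, when [N] is 1; [ph] is 0 at 0. *)
pose z j := if [pick a | unit_at j a] is Some a then ph (c a) else 0.
have z1 j : cabs (z j) <= 1.
  rewrite /z; case: pickP => [a _|_]; last by rewrite cabs0.
  rewrite /ph cabsM cabs_conj.
  have [->|x0] := eqVneq (c a) 0; first by rewrite cabs0 mul0r.
  by rewrite cabsV cabs_real ?cabs_ge0 // divff // cabs_eq0.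
have zE a : wt a = 1%N -> mono z (expo a) = ph (c a).
  move=> /wt1P[j aj]; rewrite /mono (bigD1 j) //= [X in _ * X]big1 ?mulr1; last first.
    by move=> i /negPf ij; rewrite /expo aj ij.
  rewrite /expo aj eqxx expr1 /z; case: pickP => [b /forallP bj|/(_ a) /negP []].
    by have -> : b = a by apply: expo_inj => i; rewrite /expo aj; apply/eqP.
  by apply/forallP => i; rewrite aj.
have := c1 z z1.
have -> : polyval c z = (\sum_a cabs (c a))%:C.
  rewrite rmorph_sum; apply: eq_bigr => a _ /=.
  have [a1|/hc ->] := eqVneq (wt a) 1%N; last by rewrite mul0r cabs0.
  rewrite zE // /ph mulrA -cabs_sqr rmorphXn /=.
  have [->|x0] := eqVneq (c a) 0; first by rewrite cabs0 expr0n mul0r.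
  rewrite expr2 mulfK //; apply: contra x0 => /eqP /complexI /eqP.
  by rewrite cabs_eq0.
by rewrite cabs_real // sumr_ge0 // => a _; exact: cabs_ge0.
Qed.

(* The leading coefficient c must satisfy 2 c ln (4/3) >= 3/2, so that passing
   from m to 3m/4 gains the m^(3/2) lost in BH_step; and 26/100 <= ln (4/3). *)
Definition growth (R : realType) (x : R) : R := 75 / 26 * x ^+ 2 + 50 * x.

Lemma growth_le (R : realType) (x y : R) : 0 <= x -> x <= y -> growth x <= growth y.
Proof.
move=> x0 xy; apply: lerD; last by rewrite ler_wpM2l // ler0n.
by rewrite ler_wpM2l ?divr_ge0 ?ler0n // lerXn2r // nnegrE (le_trans x0).
Qed.

Lemma ln43_bounds (R : realType) : (26 / 100 <= ln (4 / 3) :> R) && (ln (4 / 3) <= 1 / 3 :> R).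
Proof.
apply/andP; split; last first.
  have -> : 4 / 3 = 1 + 1 / 3 :> R by lra.
  by apply: le_ln1Dx; lra.
rewrite -ler_expR lnK ?posrE; last by lra.
(* Halving the exponent sharpens the tangent bound: [expR (26 / 100) <= (100 / 87)^2 <= 4 / 3]. *)
have h : 1 - 13 / 100 <= expR (- (13 / 100)) :> R by have := @expR_ge1Dx R (- (13 / 100)); lra.
have -> : 26 / 100 = 2%:R * (13 / 100) :> R by lra.
rewrite expRM_natl.
have e0 : 0 < expR (13 / 100) :> R by exact: expR_gt0.
have : expR (13 / 100) * (1 - 13 / 100) <= 1 :> R.
  by have := ler_wpM2l (ltW e0) h; rewrite expRN divff // gt_eqF.
move: (expR (13 / 100)) e0 => e e0 he.
have e1 : e <= 100 / 87 by lra.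
have : e ^+ 2 <= (100 / 87) ^+ 2 by rewrite lerXn2r // nnegrE; lra.
lra.
Qed.

Lemma BH_quasipolynomial (R : realType) m : (0 < m)%N ->
  BH m (expR (growth (ln (m%:R : R)))).
Proof.
elim/ltn_ind: m => m IH m0.
have [m1|m2] := leqP m 1.
  have -> : m = 1%N by lia.
  by rewrite ln1 /growth expr0n /= !mulr0 addr0 expR0; exact: BH_degree1.
have /andP[L1 L2] := ln43_bounds R.
set L := ln (4 / 3) in L1 L2; set x := ln (m%:R : R).
have mR : 0 < m%:R :> R by rewrite ltr0n.
have step k : (m <= 4 * k)%N -> (4 * k <= 3 * m)%N -> BH k (expR (growth (x - L))).
  move=> k1 k2; have k0 : (0 < k)%N by lia.
  have kR : 0 < k%:R :> R by rewrite ltr0n.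
  apply: (BH_le _ _ (IH k _ k0)); [exact: expR_ge0| |lia].
  rewrite ler_expR; apply: growth_le; first by rewrite ln_ge0 // ler1n.
  have -> : x - L = ln (m%:R / (4 / 3)) by rewrite ln_div ?posrE //; lra.
  rewrite ler_ln ?posrE //; last by rewrite divr_gt0 //; lra.
  have : (4 * k)%:R <= (3 * m)%:R :> R by rewrite ler_nat.
  by rewrite !natrM; lra.
have D0 : 0 < expR (growth (x - L)) by exact: expR_gt0.
apply: BH_le (BH_step m2 D0 step); first by rewrite !mulr_ge0 ?expR_ge0 ?sqrtr_ge0.
have -> : Num.sqrt m%:R = expR (2^-1 * x).
  by rewrite -powR12_sqrt // powR_expR.
have -> : m%:R = expR x by rewrite lnK ?posrE.
have h224 : 224 <= expR 8 :> R.
  have e1 : 2 <= expR 1 :> R by have := @expR_ge1Dx R 1; lra.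
  have -> : 8 = 8%:R * 1 :> R by rewrite mulr1.
  rewrite expRM_natl; apply: (@le_trans _ _ (2 ^+ 8)); first by rewrite -natrX ler_nat.
  by rewrite lerXn2r // nnegrE ?ler0n // expR_ge0.
apply: (@le_trans _ _ (expR 8 * (expR x * expR (2^-1 * x)) * expR (growth (x - L)))).
  by rewrite !ler_wpM2r ?expR_ge0 // mulr_ge0 ?expR_ge0.
(* Passing from [x] to [x - L] gains [75/13 L x >= 3/2 x] from the quadratic term; the linear one
   gains [50 L >= 13], covering the 8 and the loss [75/26 L^2]. *)
rewrite -!expRD ler_expR /growth.
have x0 : 0 <= x by rewrite ln_ge0 // ler1n.
have h1 : 26 / 100 * x <= L * x by rewrite ler_wpM2r.
have h2 : L ^+ 2 <= 1 by rewrite expr_le1 //; lra.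
have -> : (x - L) ^+ 2 = x ^+ 2 - 2 * (L * x) + L ^+ 2 by ring.
lra.
Qed.

(** * Polynomials as coefficient families *)

Local Open Scope classical_set_scope.

Definition mnm_of_expo n N (f : {ffun 'I_n -> 'I_N}) : multinom n :=
  Multinom [tuple (f i : nat) | i < n].

Lemma mnm_of_expoE n N (f : {ffun 'I_n -> 'I_N}) i : mnm_of_expo f i = f i :> nat.
Proof. by rewrite multinomE tnth_mktuple. Qed.

Lemma mnm_of_expo_inj n N : injective (@mnm_of_expo n N).
Proof.
move=> f g fg; apply/ffunP => i; apply: val_inj.
by rewrite /= -!mnm_of_expoE fg.
Qed.

Section Homogeneous.
Variables (R : realType) (m n : nat) (P : mpoly n R[i]).
Hypothesis hP : homogeneous m P.

Lemma homogeneous_mdeg a : a \in msupp P -> mdeg a = m.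
Proof. by move=> aP; move: hP; rewrite /homogeneous /= => /dhomogP; exact. Qed.

(** Homogeneity bounds every exponent in the support by [m], so functions into ['I_m.+1] enumerate
    all of it. *)
Lemma sum_msupp (V : nmodType) (G : multinom n -> V) :
  (forall a, a \notin msupp P -> G a = 0) ->
  \sum_(a <- msupp P) G a = \sum_(f : {ffun 'I_n -> 'I_m.+1}) G (mnm_of_expo f).
Proof.
move=> G0.
have H : perm_eq (msupp P)
    [seq mnm_of_expo f | f <- enum {ffun 'I_n -> 'I_m.+1} & mnm_of_expo f \in msupp P].
  apply: uniq_perm; first exact: msupp_uniq.
    rewrite map_inj_uniq; last exact: mnm_of_expo_inj.
    by rewrite filter_uniq // enum_uniq.
  move=> a; apply/idP/mapP => [aP|[f]]; last by rewrite mem_filter => /andP[fP _] ->.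
  have aE : mnm_of_expo [ffun i => inord (a i) : 'I_m.+1] = a.
    apply/mnmP => i; rewrite mnm_of_expoE ffunE inordK // ltnS.
    by rewrite -(homogeneous_mdeg aP) mdegE (bigD1 i) //= leq_addr.
  exists [ffun i => inord (a i)]; last exact: esym aE.
  by rewrite mem_filter mem_enum andbT aE.
rewrite (perm_big _ H) big_map big_filter big_enum_cond /= big_mkcond /=.
by apply: eq_bigr => f _; case: ifP => // /negbT /G0.
Qed.

Let c (f : {ffun 'I_n -> 'I_m.+1}) : R[i] := mcoeff (mnm_of_expo f) P.

Lemma wt_mnm_of_expo (f : {ffun 'I_n -> 'I_m.+1}) : mdeg (mnm_of_expo f) = wt f.
Proof. by rewrite mdegE; apply: eq_bigr => i _; rewrite mnm_of_expoE. Qed.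

Lemma homog_coef_mpoly : homog_coef m c.
Proof.
move=> f fm; apply/eqP; rewrite /c mcoeff_eq0; apply: contra fm.
by move/homogeneous_mdeg; rewrite wt_mnm_of_expo => ->.
Qed.

Lemma meval_polyval z : meval z P = polyval c z.
Proof.
rewrite mevalE (sum_msupp (G := fun a => mcoeff a P * \prod_i z i ^+ a i)).
  apply: eq_bigr => f _; congr (_ * _); apply: eq_bigr => j _.
  by rewrite mnm_of_expoE.
by move=> a; rewrite -mcoeff_eq0 => /eqP ->; rewrite mul0r.
Qed.

Lemma polyval_scale (r : R[i]) z : polyval c (fun j => r * z j) = r ^+ m * polyval c z.
Proof.
rewrite /polyval mulr_sumr; apply: eq_bigr => f _.
have [fm|/homog_coef_mpoly ->] := eqVneq (wt f) m; last by rewrite !mul0r mulr0.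
have -> : r ^+ m = r ^+ wt f by rewrite fm.
rewrite mulrCA; congr (_ * _); rewrite /mono -prodrXr -big_split.
by apply: eq_bigr => j _; rewrite exprMn.
Qed.

End Homogeneous.

Lemma bernoulli_pow (R : realDomainType) (e : R) m : 0 <= e <= 1 ->
  1 - m%:R * e <= (1 - e) ^+ m.
Proof.
move=> /andP[e0 e1]; elim: m => [|m IH]; first by rewrite expr0 mul0r subr0.
rewrite exprS; have h : 0 <= 1 - e by rewrite subr_ge0.
apply: le_trans (ler_wpM2l h IH).
have : 0 <= m%:R * (e * e) by rewrite !mulr_ge0.
by rewrite -natr1 -subr_ge0 => ?; rewrite -subr_ge0; lra.
Qed.

(* By homogeneity, the bound at z follows from those at r z as r tends to 1. *)
Lemma closed_polydisc_bound (R : realType) m n (P : mpoly n R[i]) B :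
  homogeneous m P -> 0 <= B ->
  (forall z, polydisc z -> cabs (meval z P) <= B) ->
  forall z, (forall j, cabs (z j) <= 1) -> cabs (meval z P) <= B.
Proof.
move=> hP B0 hB z z1; rewrite leNgt; apply/negP => Bz.
set v := cabs (meval z P) in Bz.
have v0 : 0 < v by exact: le_lt_trans Bz.
(* With this [e], Bernoulli gives [(1 - e) ^+ m > B / v]; the denominator [m + 1] makes it
   strict. *)
pose e := (1 - B / v) / m.+1%:R.
have Bv : B / v < 1 by rewrite ltr_pdivrMr // mul1r.
have Bv0 : 0 <= B / v by rewrite divr_ge0 // ltW.
have e0 : 0 < e by rewrite divr_gt0 ?ltr0n // subr_gt0.
have e1 : e <= 1.
  by rewrite ler_pdivrMr ?ltr0n // mul1r (le_trans (_ : _ <= 1)) ?ler1n // gerBl.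
have em : m%:R * e < 1 - B / v.
  rewrite /e mulrA ltr_pdivrMr ?ltr0n // mulrC ltr_pM2l ?subr_gt0 //.
  by rewrite ltr_nat.
have r0 : 0 <= 1 - e by rewrite subr_ge0.
have /hB : polydisc (fun j => (1 - e)%:C * z j).
  move=> j; rewrite /= cabsM cabs_real //.
  by rewrite (le_lt_trans (ler_wpM2l r0 (z1 j))) // mulr1 ltrBlDr ltrDl.
rewrite (meval_polyval hP) (polyval_scale hP) -(meval_polyval hP) cabsM cabsX cabs_real // -/v.
rewrite leNgt -ltr_pdivrMr // => /negP; apply.
have be : 0 <= e <= 1 by rewrite ltW.
by apply: lt_le_trans (bernoulli_pow m be); rewrite ltrBrDr addrC -ltrBrDr.
Qed.

Lemma coefnorm_le (R : realType) m n (P : mpoly n R[i]) B D :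
  (0 < m)%N -> 0 <= D -> BH m D -> homogeneous m P -> 0 < B ->
  (forall z, polydisc z -> cabs (meval z P) <= B) ->
  coefnorm (BHexp R m) P <= D * B.
Proof.
move=> m0 D0 hBH hP B0 hB.
have hB' := closed_polydisc_bound hP (ltW B0) hB.
pose c (f : {ffun 'I_n -> 'I_m.+1}) : R[i] := mcoeff (mnm_of_expo f) P.
have pE : BHexp R m = 2%:R * rho R m by rewrite /BHexp /rho natrM mulrA.
have p0 : 0 < BHexp R m by rewrite pE mulr_gt0 // rho_gt0.
have H := hBH n m.+1 (fun f => (B^-1)%:C * c f).
have {H} : \sum_f (cabs ((B^-1)%:C * c f) ^+ 2) `^ rho R m <= (D ^+ 2) `^ rho R m.
  apply: H; first by move=> f /(homog_coef_mpoly hP) cf; rewrite /c cf mulr0.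
  move=> z z1; have -> : polyval (fun f => (B^-1)%:C * c f) z = (B^-1)%:C * meval z P.
    rewrite (meval_polyval hP) /polyval mulr_sumr; apply: eq_bigr => f _.
    by rewrite mulrA.
  by rewrite cabsM cabs_real ?invr_ge0 ?(ltW B0) // mulrC ler_pdivrMr // mul1r hB'.
have sqrp (x : R) : 0 <= x -> (x ^+ 2) `^ rho R m = x `^ BHexp R m.
  by move=> x0; rewrite -powR_mulrn // -powRrM pE.
have -> : \sum_f (cabs ((B^-1)%:C * c f) ^+ 2) `^ rho R m =
    (\sum_f cabs (c f) `^ BHexp R m) / B `^ BHexp R m.
  rewrite mulr_suml; apply: eq_bigr => f _.
  rewrite sqrp ?cabs_ge0 // cabsM cabs_real ?invr_ge0 ?(ltW B0) // mulrC powR_div ?cabs_ge0 //.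
rewrite sqrp // ler_pdivrMr ?powR_gt0 // -(powRM _ D0 (ltW B0)).
rewrite /coefnorm (sum_msupp hP (G := fun a => cabs (mcoeff a P) `^ BHexp R m)); last first.
  by move=> a; rewrite -mcoeff_eq0 => /eqP ->; rewrite cabs0 powR0 // gt_eqF.
move=> H.
have DB : D * B = ((D * B) `^ BHexp R m) `^ (BHexp R m)^-1.
  by rewrite -powRrM divff ?gt_eqF // powRr1 // mulr_ge0 // (ltW B0).
rewrite DB; apply: ge0_ler_powR => //; rewrite ?nnegrE ?powR_ge0 ?invr_ge0 ?(ltW p0) //.
by apply: sumr_ge0 => f _; exact: powR_ge0.
Qed.

Lemma BHconst_le (R : realType) m (D : R) : (0 < m)%N -> 0 <= D -> BH m D ->
  (BHconst R m <= D%:E)%E.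
Proof.
move=> m0 D0 hBH; apply: ge_ereal_sup => _ [n n1 <-].
apply: ge_ereal_sup => _ [P [hP P0] <-].
have sup_ge0 : (0 <= supnorm P)%E.
  apply: (@le_trans _ _ (cabs (meval (fun=> 0) P))%:E); first by rewrite lee_fin cabs_ge0.
  by apply: ereal_sup_ubound; exists (fun=> 0) => // j; rewrite cabs0 ltr01.
have sup_ge z : polydisc z -> ((cabs (meval z P))%:E <= supnorm P)%E.
  by move=> z1; apply: ereal_sup_ubound; exists z.
move: sup_ge0 sup_ge; case: (supnorm P) => [s| |] sup_ge0 sup_ge //.
- have s0 : 0 <= s by rewrite -lee_fin.
  have cn0 : 0 <= coefnorm (BHexp R m) P by exact: powR_ge0.
  have hs z : polydisc z -> cabs (meval z P) <= s.
    by move=> /sup_ge; rewrite lee_fin.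
  (* For a vanishing supremum the quotient is harmless because the numerator vanishes too:
     [coefnorm_le] applies with arbitrarily small bounds. *)
  have [s00|sN0] := eqVneq s 0.
    suff -> : coefnorm (BHexp R m) P = 0 by rewrite mul0e lee_fin.
    apply/eqP; rewrite eq_le cn0 andbT; apply/ler_addgt0Pr => e e0.
    rewrite add0r.
    have De : 0 < e / (D + 1) by rewrite divr_gt0 // ltr_wpDl.
    apply: (le_trans (coefnorm_le m0 D0 hBH hP De _)).
      by move=> z /hs /le_trans; apply; rewrite s00 ltW.
    rewrite mulrCA ger_pMr // ler_pdivrMr ?ltr_wpDl // mul1r lerDl //.
  have sp : 0 < s by rewrite lt0r sN0.
  by rewrite inver (negPf sN0) lee_pdivrMr // -EFinM lee_fin coefnorm_le.
- by rewrite invey mule0 lee_fin.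
Qed.

Local Close Scope complex_scope.

(** * Numerical bounds and conclusion *)

(** For [x <= 1/2] each term is at most half the previous one, so the partial sum plus twice the
    next term decreases with [n]. *)
Lemma expR_taylor_bounds (R : realType) (x : R) (n : nat) : 0 <= x <= 2^-1 ->
  \sum_(0 <= i < n) x ^+ i / i`!%:R <= expR x <=
  \sum_(0 <= i < n) x ^+ i / i`!%:R + 2 * (x ^+ n / n`!%:R).
Proof.
move=> /andP[x0 x1].
pose S k : R := \sum_(0 <= i < k) x ^+ i / i`!%:R.
have term0 i : 0 <= x ^+ i / i`!%:R by rewrite divr_ge0 ?exprn_ge0.
have SS k : S k.+1 = S k + x ^+ k / k`!%:R by rewrite /S big_nat_recr.
have lower k : S n <= S (n + k)%N.
  elim: k => [|k IH]; first by rewrite addn0.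
  by rewrite addnS SS (le_trans IH) // lerDl.
have upper k : S (n + k)%N + 2 * (x ^+ (n + k) / (n + k)`!%:R) <= S n + 2 * (x ^+ n / n`!%:R).
  elim: k => [|k IH]; first by rewrite addn0.
  rewrite addnS SS; apply: le_trans IH; move: (n + k)%N => j.
  rewrite -addrA lerD2l exprS factS natrM.
  have -> : x * x ^+ j / (j.+1%:R * j`!%:R) = (x / j.+1%:R) * (x ^+ j / j`!%:R).
    by rewrite invfM mulrACA.
  have xj : x / j.+1%:R <= 2^-1.
    rewrite ler_pdivrMr ?ltr0n // (le_trans x1) // ler_peMr // ler1n //.
  have := ler_wpM2r (term0 j) xj; move: (_ / _) (x ^+ j / _) => u v; lra.
have cS : cvgn (series (exp_coeff x)) := is_cvg_series_exp_coeff x.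
have SE k : series (exp_coeff x) k = S k by [].
apply/andP; split; rewrite /expR.
- apply: limr_ge => //; exists n => // k /= nk.
  by rewrite SE -(subnKC nk) lower.
- apply: limr_le => //; exists n => // k /= nk.
  rewrite SE -/(S n) -(subnKC nk) (le_trans _ (upper (k - n)%N)) //.
  by rewrite lerDl mulr_ge0.
Qed.

Lemma ln_golden_bounds (R : realType) :
  2119 / 10 ^+ 4 + 3533 / 10 ^+ 8 <= ln (4 / (1 + Num.sqrt 5)) :> R /\
  ln (4 / (1 + Num.sqrt 5)) <= 2119 / 10 ^+ 4 + 3537 / 10 ^+ 8 :> R.
Proof.
set s : R := Num.sqrt 5.
have s0 : 0 <= s by exact: sqrtr_ge0.
have s2 : s ^+ 2 = 5 by rewrite sqr_sqrtr.
(* Rationalizing reduces the bounds to decimal enclosures of [Num.sqrt 5], checked by squaring, and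
   of [expR], by eight Taylor terms. *)
have yE : 4 / (1 + s) = s - 1.
  have s1 : 1 + s != 0 by rewrite gt_eqF // ltr_pwDl.
  have ss : s * s = 5 by rewrite -expr2.
  by apply: (mulIf s1); rewrite divfK // mulrBl mul1r mulrDr mulr1 ss; lra.
have le_s (q : R) : 0 <= q -> q ^+ 2 <= 5 -> q <= s.
  by move=> q0; rewrite -s2 ler_pXn2r.
have ge_s (q : R) : 0 <= q -> 5 <= q ^+ 2 -> s <= q.
  by move=> q0; rewrite -s2 ler_pXn2r.
have lo : 1236 / 10 ^+ 3 + 6796 / 10 ^+ 8 <= s - 1.
  have : 1 + 1236 / 10 ^+ 3 + 6796 / 10 ^+ 8 <= s by apply: le_s; lra.
  lra.
have hi : s - 1 <= 1236 / 10 ^+ 3 + 6798 / 10 ^+ 8.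
  have : s <= 1 + 1236 / 10 ^+ 3 + 6798 / 10 ^+ 8 by apply: ge_s; lra.
  lra.
have y0 : 0 < s - 1 by lra.
have lnK' : expR (ln (s - 1)) = s - 1 by apply: lnK; rewrite posrE.
rewrite yE; split; rewrite -ler_expR lnK'.
- apply: le_trans lo.
  have /andP[_ +] := @expR_taylor_bounds R (2119 / 10 ^+ 4 + 3533 / 10 ^+ 8) 8 ltac:(lra).
  move=> h; apply: (le_trans h).
  rewrite unlock /= !factS fact0; lra.
- apply: (le_trans hi).
  have /andP[+ _] := @expR_taylor_bounds R (2119 / 10 ^+ 4 + 3537 / 10 ^+ 8) 8 ltac:(lra).
  apply: le_trans.
  rewrite unlock /= !factS fact0; lra.
Qed.

Lemma BHrate_bounds (R : realType) :
  2949 / 10 ^+ 3 + 12 / 10 ^+ 6 <= BHrate R < 2949 / 10 ^+ 3 + 13 / 10 ^+ 6.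
Proof.
have [lo hi] := ln_golden_bounds R; rewrite /BHrate.
set L := ln _ in lo hi *.
have L0 : 0 < 8 * L by lra.
by apply/andP; split; [rewrite ler_pdivlMr | rewrite ltr_pdivrMr] => //; lra.
Qed.

Lemma growth_eventually (R : realType) :
  \forall m \near \oo, growth (ln (m%:R : R)) <= BHrate R * ln (m%:R : R) ^+ 2.
Proof.
near=> m.
(* The gap between [BHrate R] and [75 / 26] exceeds 0.064, so [x >= 800] lets it absorb the linear
   term [50 * x]. *)
have hm : expR 800 <= m%:R :> R by near: m; exact: nbhs_infty_ger.
have m0 : 0 < m%:R :> R by apply: lt_le_trans hm; exact: expR_gt0.
have x800 : 800 <= ln (m%:R : R) by rewrite -ler_expR lnK ?posrE.
have /andP[b _] := BHrate_bounds R.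
have x0 : 0 <= ln (m%:R : R) by apply: le_trans (ler0n _ _) x800.
move: (ln _) x800 x0 => x x800 x0.
have := ler_wpM2r (sqr_ge0 x) b.
have := ler_wpM2r x0 x800; rewrite /growth expr2; lra.
Unshelve. all: by end_near. Qed.

Lemma BHconst_eventually (R : realType) :
  \forall m \near \oo,
    (BHconst R m <= (expR (BHrate R * ln (m%:R : R) ^+ 2))%:E)%E.
Proof.
near=> m.
have m0 : (0 < m)%N by near: m; exact: nbhs_infty_gt.
apply: (le_trans (BHconst_le m0 (expR_ge0 _) (@BH_quasipolynomial R m m0))).
by rewrite lee_fin ler_expR; near: m; exact: growth_eventually.
Unshelve. all: by end_near. Qed.

Theorem theorem4p5 (R : realType) :
  [/\ (limn_esup (fun m : nat =>
         (lne (BHconst R m) / ((ln (m%:R : R)) ^+ 2)%:E)%E)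
       <= (BHrate R)%:E)%E,
      2949 / 10 ^+ 3 + 12 / 10 ^+ 6 <= BHrate R < 2949 / 10 ^+ 3 + 13 / 10 ^+ 6,
      BHrate R < 295 / 100
    & exists eps : nat -> R,
        eps @ \oo --> (0 : R) /\
        \forall m \near \oo,
          (BHconst R m <=
           (expR ((BHrate R + eps m) * (ln (m%:R : R)) ^+ 2))%:E)%E].
Proof.
have bounds := BHrate_bounds R.
split => //.
- have /= [m0 _ hm0] := BHconst_eventually R.
  rewrite /limn_esup /limf_esup; apply: ereal_inf_le.
  (* The limit superior is bounded by the supremum over one tail; starting at 2 makes [ln m]
     nonzero. *)
  exists (ereal_sup ((fun m : nat => (lne (BHconst R m) / (ln (m%:R : R) ^+ 2)%:E)%E) @`
     [set m | (maxn 2 m0 <= m)%N])).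
    by exists [set m | (maxn 2 m0 <= m)%N] => //; exists (maxn 2 m0).
  apply: ge_ereal_sup => _ [m /= m2 <-].
  move: m2; rewrite geq_max => /andP[m2 mm0].
  have := hm0 _ mm0; set x := ln (m%:R : R) => hm.
  have x0 : 0 < x ^+ 2 by rewrite exprn_gt0 // ln_gt0 // ltr1n.
  rewrite inver gt_eqF // lee_pdivrMr // -EFinM.
  (* [lne] is [-oo] at nonpositive arguments, and monotone on the others. *)
  have [b0|b0] := leP (BHconst R m) 0%E; first by rewrite le0_lneNy // leNye.
  have <- : lne (expR (BHrate R * x ^+ 2))%:E = (BHrate R * x ^+ 2)%:E.
    by rewrite lne_EFin ?expR_gt0 // expRK.
  by rewrite lee_lne ?in_itv /= ?leey ?andbT ?(ltW b0) // lee_fin expR_ge0.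
- by move/andP: bounds => [_ b]; lra.
(* As [75 / 26 < BHrate R], the bound holds eventually with zero error. *)
- exists (fun=> 0); split; first exact: cvg_cst.
  by apply: filterS (BHconst_eventually R) => m; rewrite addr0.
Qed.
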